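(* The following hold in $\mathbf{ZF}$. (i) If the Sorgenfrey line is a $k$-space, then $\mathbf{CC}(c\mathbb{R})$ holds. (ii) If $\mathbf{CC}(\mathbb{R})$ holds, then the Sorgenfrey line is a $k$-space.
   Context: All work is in $\mathbf{ZF}$ (no axiom of choice). The Sorgenfrey line is the set $\mathbb{R}$ with the topology having as an open base the collection of all half-open intervals $[a,b)$ with $a,b\in\mathbb{R}$, $a<b$. A Hausdorff space $Z$ is called a $k$-space if, for every $A\subseteq Z$, $A$ is closed in $Z$ if and only if $A\cap K$ is closed in $Z$ for each compact set $K$ in $Z$ (compact: every open cover has a finite subcover). $\mathbf{CC}(\mathbb{R})$ is the statement: every non-empty countable collection of non-empty subsets of $\mathbb{R}$ has a choice function. $\mathbf{CC}(c\mathbb{R})$ is the statement: every non-empty countable collection of non-empty complete subspaces of $\mathbb{R}$ has a choice function, where $\mathbb{R}$ is considered with the metric $\rho(x,y)=|x-y|$ and a subspace is complete if each of its Cauchy sequences converges in it. *)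

(* Defs.v *)
(* "Holds in ZF" is read as "holds in every model of ZF": a model is an
   arbitrary type with a binary relation satisfying the first-order ZF axioms,
   and every notion below is relativized to that model, i.e. it quantifies only
   over elements of the model.  Stating the notions about Rocq's own types would
   not do: choice axioms consistent with (and often assumed in) Rocq would then
   apply to them. *)

Record set_structure : Type := {
  universe :> Type;
  mem : universe -> universe -> Prop }.

Arguments mem {_} _ _.

Declare Scope zf_scope.
Notation "x ∈ y" := (mem x y) (at level 70, no associativity) : zf_scope.
Open Scope zf_scope.

(* Variables are de Bruijn indices. *)
Inductive formula : Type :=
| f_mem (i j : nat)
| f_eq (i j : nat)
| f_false
| f_imp (p q : formula)
| f_and (p q : formula)
| f_or (p q : formula)
| f_all (p : formula)
| f_ex (p : formula).

Definition scons {T : Type} (a : T) (e : nat -> T) (n : nat) : T :=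
  match n with O => a | S k => e k end.

Fixpoint sat (M : set_structure) (e : nat -> M) (p : formula) : Prop :=
  match p with
  | f_mem i j => e i ∈ e j
  | f_eq i j => e i = e j
  | f_false => False
  | f_imp p q => sat M e p -> sat M e q
  | f_and p q => sat M e p /\ sat M e q
  | f_or p q => sat M e p \/ sat M e q
  | f_all p => forall a : M, sat M (scons a e) p
  | f_ex p => exists a : M, sat M (scons a e) p
  end.

Definition nonempty {M : set_structure} (x : M) : Prop := exists y, y ∈ x.

Definition subset {M : set_structure} (x y : M) : Prop :=
  forall z, z ∈ x -> z ∈ y.

Notation "x ⊆ y" := (subset x y) (at level 70, no associativity) : zf_scope.

(* The operations of set theory are given by their graphs; the last argument
   is the value. *)
Definition is_upair {M : set_structure} (x y u : M) : Prop :=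
  forall z, z ∈ u <-> z = x \/ z = y.

Definition is_union {M : set_structure} (C U : M) : Prop :=
  forall z, z ∈ U <-> exists A, A ∈ C /\ z ∈ A.

Definition is_inter {M : set_structure} (A B I : M) : Prop :=
  forall z, z ∈ I <-> z ∈ A /\ z ∈ B.

Definition is_diff {M : set_structure} (A B D : M) : Prop :=
  forall z, z ∈ D <-> z ∈ A /\ ~ z ∈ B.

Definition is_succ {M : set_structure} (n s : M) : Prop :=
  forall z, z ∈ s <-> z ∈ n \/ z = n.

Definition inductive_set {M : set_structure} (w : M) : Prop :=
  (exists o, (forall z, ~ z ∈ o) /\ o ∈ w) /\
  (forall n, n ∈ w -> exists s, is_succ n s /\ s ∈ w).

(* Kuratowski pairs. *)
Definition is_opair {M : set_structure} (x y p : M) : Prop :=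
  exists s u, is_upair x x s /\ is_upair x y u /\ is_upair s u p.

(* Separation and replacement are schemas over first-order formulas with
   parameters, not over arbitrary Rocq predicates on the model. *)
Record ZF (M : set_structure) : Prop := {
  zf_extensionality :
    forall x y : M, (forall z, z ∈ x <-> z ∈ y) -> x = y;
  zf_foundation :
    forall x : M, nonempty x ->
      exists y, y ∈ x /\ forall z, z ∈ y -> ~ z ∈ x;
  zf_pairing :
    forall x y : M, exists u, is_upair x y u;
  zf_union :
    forall C : M, exists U, is_union C U;
  zf_powerset :
    forall x : M, exists P, forall z, z ∈ P <-> z ⊆ x;
  zf_infinity :
    exists w : M, inductive_set w;
  zf_separation :
    forall (p : formula) (e : nat -> M) (x : M),
      exists y, forall z, z ∈ y <-> z ∈ x /\ sat M (scons z e) p;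
  zf_replacement :
    forall (p : formula) (e : nat -> M) (x : M),
      (forall a, a ∈ x -> exists! b, sat M (scons a (scons b e)) p) ->
      exists y, forall b,
        b ∈ y <-> exists a, a ∈ x /\ sat M (scons a (scons b e)) p }.

(* f(x) = y; for a relation f it reads "x f y". *)
Definition maps {M : set_structure} (f x y : M) : Prop :=
  exists p, is_opair x y p /\ p ∈ f.

(* f(x,y) = z *)
Definition maps2 {M : set_structure} (f x y z : M) : Prop :=
  exists p, is_opair x y p /\ maps f p z.

Definition is_function {M : set_structure} (f A B : M) : Prop :=
  (forall p, p ∈ f -> exists x y, x ∈ A /\ y ∈ B /\ is_opair x y p) /\
  (forall x, x ∈ A -> exists! y, maps f x y).

Definition is_injective {M : set_structure} (f : M) : Prop :=
  forall x x' y, maps f x y -> maps f x' y -> x = x'.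

Definition is_surjective {M : set_structure} (f B : M) : Prop :=
  forall y, y ∈ B -> exists x, maps f x y.

Definition is_binop {M : set_structure} (f A : M) : Prop :=
  (forall q, q ∈ f -> exists x y z p,
     x ∈ A /\ y ∈ A /\ z ∈ A /\ is_opair x y p /\ is_opair p z q) /\
  (forall x y, x ∈ A -> y ∈ A -> exists! z, maps2 f x y z).

Definition is_omega {M : set_structure} (omega : M) : Prop :=
  inductive_set omega /\ forall w, inductive_set w -> omega ⊆ w.

Definition is_finite {M : set_structure} (omega C : M) : Prop :=
  exists n f, n ∈ omega /\
    is_function f C n /\ is_injective f /\ is_surjective f n.

(* Countable means finite or denumerable. *)
Definition is_countable {M : set_structure} (omega C : M) : Prop :=
  exists f, is_function f C omega /\ is_injective f.

Definition is_choice_function {M : set_structure} (f C : M) : Prop :=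
  (exists U, is_union C U /\ is_function f C U) /\
  (forall A a, maps f A a -> a ∈ A).

(* The real line of a model is any complete ordered field in the model, where
   completeness concerns those subsets that belong to the model.  ZF proves
   that such a field exists and is unique up to isomorphism. *)
Record real_field (M : set_structure) : Type := {
  reals : M;
  radd : M;
  rmul : M;
  rle_graph : M;
  rzero : M;
  rone : M;

  radd_binop : is_binop radd reals;
  radd_comm : forall x y z, maps2 radd x y z -> maps2 radd y x z;
  radd_assoc : forall x y z u v w,
    maps2 radd x y u -> maps2 radd u z w -> maps2 radd y z v ->
    maps2 radd x v w;
  rzero_in : rzero ∈ reals;
  radd_zero : forall x, x ∈ reals -> maps2 radd x rzero x;
  radd_opp : forall x, x ∈ reals -> exists y, maps2 radd x y rzero;

  rmul_binop : is_binop rmul reals;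
  rmul_comm : forall x y z, maps2 rmul x y z -> maps2 rmul y x z;
  rmul_assoc : forall x y z u v w,
    maps2 rmul x y u -> maps2 rmul u z w -> maps2 rmul y z v ->
    maps2 rmul x v w;
  rone_in : rone ∈ reals;
  rmul_one : forall x, x ∈ reals -> maps2 rmul x rone x;
  rmul_inv : forall x, x ∈ reals -> x <> rzero ->
    exists y, maps2 rmul x y rone;
  rone_neq_zero : rone <> rzero;
  rmul_add : forall x y z s t u v,
    maps2 radd y z s -> maps2 rmul x s t ->
    maps2 rmul x y u -> maps2 rmul x z v -> maps2 radd u v t;

  rle_rel : forall p, p ∈ rle_graph ->
    exists x y, x ∈ reals /\ y ∈ reals /\ is_opair x y p;
  rle_refl : forall x, x ∈ reals -> maps rle_graph x x;
  rle_antisym : forall x y,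
    maps rle_graph x y -> maps rle_graph y x -> x = y;
  rle_trans : forall x y z,
    maps rle_graph x y -> maps rle_graph y z -> maps rle_graph x z;
  rle_total : forall x y, x ∈ reals -> y ∈ reals ->
    maps rle_graph x y \/ maps rle_graph y x;
  rle_add : forall x y z u v, maps rle_graph x y ->
    maps2 radd x z u -> maps2 radd y z v -> maps rle_graph u v;
  rle_mul : forall x y z,
    maps rle_graph rzero x -> maps rle_graph rzero y ->
    maps2 rmul x y z -> maps rle_graph rzero z;

  r_complete : forall A, A ⊆ reals -> nonempty A ->
    (exists b, b ∈ reals /\ forall x, x ∈ A -> maps rle_graph x b) ->
    exists s, s ∈ reals /\ (forall x, x ∈ A -> maps rle_graph x s) /\
      (forall b, b ∈ reals -> (forall x, x ∈ A -> maps rle_graph x b) ->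
         maps rle_graph s b) }.

Arguments reals {_} _.
Arguments radd {_} _.
Arguments rmul {_} _.
Arguments rle_graph {_} _.
Arguments rzero {_} _.
Arguments rone {_} _.

Definition rle {M : set_structure} (R : real_field M) (x y : M) : Prop :=
  maps (rle_graph R) x y.

Definition rlt {M : set_structure} (R : real_field M) (x y : M) : Prop :=
  rle R x y /\ x <> y.

(* x - y = d *)
Definition is_sub {M : set_structure} (R : real_field M) (x y d : M) : Prop :=
  maps2 (radd R) d y x.

(* |x| = a *)
Definition is_abs {M : set_structure} (R : real_field M) (x a : M) : Prop :=
  (rle R (rzero R) x /\ a = x) \/
  (rle R x (rzero R) /\ maps2 (radd R) x a (rzero R)).

(* |x - y| = d *)
Definition is_dist {M : set_structure} (R : real_field M) (x y d : M) : Prop :=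
  exists u, is_sub R x y u /\ is_abs R u d.

(* On omega, the order n <= m is n ⊆ m. *)
Definition cauchy {M : set_structure} (omega : M) (R : real_field M) (s : M)
  : Prop :=
  forall eps, rlt R (rzero R) eps ->
    exists N, N ∈ omega /\
      forall m n x y d, m ∈ omega -> n ∈ omega -> N ⊆ m -> N ⊆ n ->
        maps s m x -> maps s n y -> is_dist R x y d -> rlt R d eps.

Definition converges_to {M : set_structure} (omega : M) (R : real_field M)
  (s l : M) : Prop :=
  forall eps, rlt R (rzero R) eps ->
    exists N, N ∈ omega /\
      forall n x d, n ∈ omega -> N ⊆ n ->
        maps s n x -> is_dist R x l d -> rlt R d eps.

Definition complete_subspace {M : set_structure} (omega : M)
  (R : real_field M) (A : M) : Prop :=
  A ⊆ reals R /\
  forall s, is_function s omega A -> cauchy omega R s ->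
    exists l, l ∈ A /\ converges_to omega R s l.

Definition CC_R {M : set_structure} (omega : M) (R : real_field M) : Prop :=
  forall C, nonempty C -> is_countable omega C ->
    (forall A, A ∈ C -> nonempty A /\ A ⊆ reals R) ->
    exists f, is_choice_function f C.

Definition CC_cR {M : set_structure} (omega : M) (R : real_field M) : Prop :=
  forall C, nonempty C -> is_countable omega C ->
    (forall A, A ∈ C -> nonempty A /\ complete_subspace omega R A) ->
    exists f, is_choice_function f C.

Definition is_topology {M : set_structure} (X tau : M) : Prop :=
  (forall U, U ∈ tau -> U ⊆ X) /\
  (forall o, (forall z, ~ z ∈ o) -> o ∈ tau) /\
  X ∈ tau /\
  (forall U V I, U ∈ tau -> V ∈ tau -> is_inter U V I -> I ∈ tau) /\
  (forall C U, C ⊆ tau -> is_union C U -> U ∈ tau).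

Definition is_base {M : set_structure} (B tau : M) : Prop :=
  B ⊆ tau /\ forall U, U ∈ tau -> exists C, C ⊆ B /\ is_union C U.

Definition is_closed {M : set_structure} (X tau A : M) : Prop :=
  A ⊆ X /\ exists D, is_diff X A D /\ D ∈ tau.

Definition is_hausdorff {M : set_structure} (X tau : M) : Prop :=
  forall x y, x ∈ X -> y ∈ X -> x <> y ->
    exists U V, U ∈ tau /\ V ∈ tau /\ x ∈ U /\ y ∈ V /\
      forall z, ~ (z ∈ U /\ z ∈ V).

Definition covers {M : set_structure} (C K : M) : Prop :=
  forall x, x ∈ K -> exists U, U ∈ C /\ x ∈ U.

Definition is_compact {M : set_structure} (omega X tau K : M) : Prop :=
  K ⊆ X /\
  forall C, C ⊆ tau -> covers C K ->
    exists F, F ⊆ C /\ is_finite omega F /\ covers F K.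

Definition k_space {M : set_structure} (omega X tau : M) : Prop :=
  is_topology X tau /\ is_hausdorff X tau /\
  forall A, A ⊆ X ->
    (is_closed X tau A <->
     forall K, is_compact omega X tau K ->
       forall I, is_inter A K I -> is_closed X tau I).

(* I = [a,b) *)
Definition is_half_open {M : set_structure} (R : real_field M) (a b I : M)
  : Prop :=
  forall x, x ∈ I <-> rle R a x /\ rlt R x b.

Definition sorgenfrey_topology {M : set_structure} (R : real_field M) (tau : M)
  : Prop :=
  is_topology (reals R) tau /\
  exists B, is_base B tau /\
    forall I, I ∈ B <-> exists a b, rlt R a b /\ is_half_open R a b I.

(* Main.v *)
(* Every complete subspace A of R is Sorgenfrey-closed as soon as the Sorgenfrey
   line is a k-space.  A compact K of the Sorgenfrey line has a gap to the left of
   every point, so that every nonempty subset of K that is bounded above has a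
   maximum.  Hence, if the points of A ∩ K accumulate at x from the right, the maxima
   of A ∩ K ∩ (x, x + 2^-n) form a sequence that needs no choice, and
   completeness puts its limit x into A.  A Sorgenfrey-closed set contains the
   infimum of each of its nonempty sections [c, oo), which gives a canonical
   element: take c = 0 if A meets [0, oo), and c = sup A - 1 otherwise.

   Conversely, if A is not closed at x, CC(R) picks a_n in A ∩ [x, x + 2^-n); the
   set of x and the a_n is compact and its trace on A is not closed. *)
From HB Require Import structures.
From mathcomp Require Import all_boot all_order all_algebra boolp lra.
Require Import Defs.

Set Implicit Arguments.
Unset Strict Implicit.
Unset Printing Implicit Defensive.

Import Order.TTheory GRing.Theory Num.Theory.

(** * Definable predicates *)

(** The model may be non-standard: its [omega] may have elements that no [nat] names, its finite
    sets may be infinite for Rocq, and its field need not be Archimedean with respect to [nat].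
    Induction, the numbers 2^-n and the passage to a finite subcover therefore take place inside the
    model, and each such step costs a proof that the property involved is definable. Likewise, a
    sequence or a choice function counts only once it is an element of the model. Choice in Rocq is
    harmless: it serves to name objects that are unique, and every set that is built comes from a
    definable description. The topology sees approach from the right only: [[x, oo)] is open as well
    as closed. Covering a compact set by this ray and by rays that end before [x] gives the left
    gap. A closed set may miss its supremum, so the canonical element has to be an infimum. *)

Fixpoint rename (r : nat -> nat) (p : formula) : formula :=
  let lift n := if n is k.+1 then (r k).+1 else 0 in
  match p with
  | f_mem i j => f_mem (r i) (r j)
  | f_eq i j => f_eq (r i) (r j)
  | f_false => f_false
  | f_imp p q => f_imp (rename r p) (rename r q)
  | f_and p q => f_and (rename r p) (rename r q)
  | f_or p q => f_or (rename r p) (rename r q)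
  | f_all p => f_all (rename lift p)
  | f_ex p => f_ex (rename lift p)
  end.

Section Definability.
Context (M : set_structure).
Implicit Types (e : nat -> M) (P Q : (nat -> M) -> Prop).

Lemma sat_rename p r e : sat M e (rename r p) <-> sat M (fun n => e (r n)) p.
Proof.
elim: p r e => //=.
- by move=> p IHp q IHq r e; rewrite IHp IHq.
- by move=> p IHp q IHq r e; rewrite IHp IHq.
- by move=> p IHp q IHq r e; rewrite IHp IHq.
- move=> p IHp r e; split=> H a; move: (H a); rewrite IHp;
  by congr (sat M _ p); apply: funext => -[].
- move=> p IHp r e; split=> -[a H]; exists a; move: H; rewrite IHp;
  by congr (sat M _ p); apply: funext => -[].
Qed.

Definition assign e (v : nat + M) : M := match v with inl k => e k | inr c => c end.

(* Separation and replacement hold for formulas only, so the predicate behind each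
   set that is formed has to be definable.  [v] sends each free variable of [p] to
   an argument of [P] or to a constant of the model. *)
Definition definable P : Prop :=
  exists p (v : nat -> nat + M), forall e,
    sat M (fun n => assign e (v n)) p <-> P e.

Definition definable_fun (t : (nat -> M) -> M) : Prop :=
  definable (fun e => e 0 = t (fun n => e n.+1)).

Lemma definable_iff P Q : (forall e, P e <-> Q e) -> definable P -> definable Q.
Proof. by move=> PQ [p [v H]]; exists p, v => e; rewrite H. Qed.

Lemma definable_subst P (f : nat -> nat + M) :
  definable P -> definable (fun e => P (fun n => assign e (f n))).
Proof.
move=> [p [v H]].
exists p, (fun n => if v n is inl k then f k else v n) => e.
rewrite -H; suff -> : (fun n => assign e (if v n is inl k then f k else v n)) =
  (fun n => assign (fun m => assign e (f m)) (v n)) by [].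
by apply: funext => n; case: (v n).
Qed.

(** The variables of [p] go to even indices and those of [q] to odd ones, so that the valuations [v]
    and [w] interleave without conflict. *)
Lemma definable_binary (c : formula -> formula -> formula)
    (op : Prop -> Prop -> Prop) P Q :
  (forall e p q, sat M e (c p q) <-> op (sat M e p) (sat M e q)) ->
  definable P -> definable Q -> definable (fun e => op (P e) (Q e)).
Proof.
move=> Hc [p [v Hp]] [q [w Hq]].
exists (c (rename (fun n => n.*2) p) (rename (fun n => n.*2.+1) q)).
exists (fun n => if odd n then w n./2 else v n./2) => e.
rewrite Hc !(propext (sat_rename _ _ _)) -(propext (Hp e)) -(propext (Hq e)).
suff [-> ->] : (fun n => assign e (if odd n.*2 then w n.*2./2 else v n.*2./2)) =
    (fun n => assign e (v n)) /\
  (fun n => assign e (if odd n.*2.+1 then w n.*2.+1./2 else v n.*2.+1./2)) =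
    (fun n => assign e (w n)) by [].
by split; apply: funext => n; rewrite ?oddS odd_double /= ?uphalf_double ?doubleK.
Qed.

Lemma definable_and P Q :
  definable P -> definable Q -> definable (fun e => P e /\ Q e).
Proof. by apply: (@definable_binary f_and). Qed.

Lemma definable_or P Q :
  definable P -> definable Q -> definable (fun e => P e \/ Q e).
Proof. by apply: (@definable_binary f_or). Qed.

Lemma definable_imp P Q :
  definable P -> definable Q -> definable (fun e => P e -> Q e).
Proof. by apply: (@definable_binary f_imp (fun A B => A -> B)). Qed.

Lemma definable_false : definable (fun=> False).
Proof. by exists f_false, inl. Qed.

Lemma definable_not P : definable P -> definable (fun e => ~ P e).
Proof. by move=> HP; apply: definable_imp => //; exact: definable_false. Qed.

Lemma definable_iff_rel P Q :
  definable P -> definable Q -> definable (fun e => P e <-> Q e).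
Proof. by move=> HP HQ; apply: definable_and; apply: definable_imp. Qed.

(** Several indices of [p] may be sent to argument 0, which is about to be bound. They are merged
    into the bound variable, and every other index moves up by one and keeps its own argument or
    constant. *)
Lemma definable_binder (v : nat -> nat + M) p :
  exists q w, forall a e,
    sat M (scons a (fun n => assign e (w n))) q <->
    sat M (fun n => assign (scons a e) (v n)) p.
Proof.
exists (rename (fun n => if v n is inl 0 then 0 else n.+1) p).
exists (fun n => match v n with inl k => inl k.-1 | inr c => inr c end) => a e.
rewrite sat_rename.
suff -> : (fun n => scons a
    (fun m => assign e (match v m with inl k => inl k.-1 | inr c => inr c end))
    (if v n is inl 0 then 0 else n.+1)) =
  (fun n => assign (scons a e) (v n)) by [].
by apply: funext => n /=; case E: (v n) => [[|k]|c] //=; rewrite E.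
Qed.

Lemma definable_all (Q : (nat -> M) -> M -> Prop) :
  definable (fun e => Q (fun n => e n.+1) (e 0)) ->
  definable (fun e => forall a, Q e a).
Proof.
move=> [p [v H]]; have [q [w Hq]] := definable_binder v p.
exists (f_all q), w => e /=; split=> Ha a.
  by apply/(H (scons a e))/Hq/Ha.
by apply/Hq/(H (scons a e))/Ha.
Qed.

Lemma definable_ex (Q : (nat -> M) -> M -> Prop) :
  definable (fun e => Q (fun n => e n.+1) (e 0)) ->
  definable (fun e => exists a, Q e a).
Proof.
move=> [p [v H]]; have [q [w Hq]] := definable_binder v p.
exists (f_ex q), w => e /=; split=> -[a Ha]; exists a.
  by apply/(H (scons a e))/Hq/Ha.
by apply/Hq/(H (scons a e))/Ha.
Qed.

Lemma definable_ex1 (Q : (nat -> M) -> M -> Prop) :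
  definable (fun e => Q (fun n => e n.+1) (e 0)) ->
  definable (fun e => exists! a, Q e a).
Proof.
move=> HQ; apply: definable_ex; apply: definable_and => //.
apply: definable_all; apply: definable_imp.
  by apply: (definable_subst (fun n => if n is m.+1 then inl m.+2 else inl 0)) HQ.
by exists (f_eq 1 0), inl.
Qed.

Lemma definable_fun_var k : definable_fun (fun e => e k).
Proof. by exists (f_eq 0 1), (fun n => inl (if n is 0 then 0 else k.+1)). Qed.

Lemma definable_fun_const c : definable_fun (fun=> c).
Proof. by exists (f_eq 0 1), (fun n => if n is 0 then inl 0 else inr c). Qed.

(** The language has no function symbols: a value [t e] enters a formula through its graph, under an
    existential quantifier. *)
Lemma definable_app (Q : (nat -> M) -> M -> Prop) t :
  definable (fun e => Q (fun n => e n.+1) (e 0)) -> definable_fun t ->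
  definable (fun e => Q e (t e)).
Proof.
move=> HQ Ht; apply: (definable_iff (P := fun e => exists a, a = t e /\ Q e a)).
  by move=> e; split=> [[a [-> //]]|H]; exists (t e).
by apply: definable_ex; apply: definable_and.
Qed.

Lemma definable_fun_shift t (f : nat -> nat) :
  definable_fun t -> definable_fun (fun e => t (fun n => e (f n))).
Proof.
by apply: (definable_subst (fun n => inl (if n is m.+1 then (f m).+1 else 0))).
Qed.

Lemma definable_app1 (Q : M -> Prop) t :
  definable (fun e => Q (e 0)) -> definable_fun t ->
  definable (fun e => Q (t e)).
Proof. exact: (definable_app (Q := fun e a => Q a)). Qed.

Lemma definable_app2 (Q : M -> M -> Prop) s t :
  definable (fun e => Q (e 0) (e 1)) -> definable_fun s -> definable_fun t ->
  definable (fun e => Q (s e) (t e)).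
Proof.
move=> HQ Hs Ht; apply: (definable_app (Q := fun e a => Q a (t e))) Hs.
apply: (definable_app (Q := fun e a => Q (e 0) a)); last exact: definable_fun_shift.
by apply: (definable_subst (fun n => if n is 0 then inl 1 else inl 0)) HQ.
Qed.

Lemma definable_app3 (Q : M -> M -> M -> Prop) r s t :
  definable (fun e => Q (e 0) (e 1) (e 2)) ->
  definable_fun r -> definable_fun s -> definable_fun t ->
  definable (fun e => Q (r e) (s e) (t e)).
Proof.
move=> HQ Hr Hs Ht; apply: (definable_app (Q := fun e a => Q a (s e) (t e))) Hr.
apply: (definable_app (Q := fun e a => Q (e 0) a (t (fun n => e n.+1))));
  last exact: definable_fun_shift.
apply: (definable_app (Q := fun e a => Q (e 1) (e 0) a));
  last exact: (definable_fun_shift (fun n => n.+2)).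
apply: (definable_subst
  (fun n => match n with 0 => inl 2 | 1 => inl 1 | _ => inl 0 end)) HQ.
Qed.

Lemma definable_mem s t :
  definable_fun s -> definable_fun t -> definable (fun e => s e ∈ t e).
Proof. by apply: definable_app2; exists (f_mem 0 1), inl. Qed.

Lemma definable_eq s t :
  definable_fun s -> definable_fun t -> definable (fun e => s e = t e).
Proof. by apply: definable_app2; exists (f_eq 0 1), inl. Qed.

Lemma definable_fun_app1 (f : M -> M) s :
  definable (fun e => e 0 = f (e 1)) -> definable_fun s ->
  definable_fun (fun e => f (s e)).
Proof.
move=> Hf Hs; apply: (definable_app2 (Q := fun a b => a = f b)) => //.
  exact: definable_fun_var.
exact: definable_fun_shift.
Qed.

Lemma definable_fun_app2 (f : M -> M -> M) s t :
  definable (fun e => e 0 = f (e 1) (e 2)) ->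
  definable_fun s -> definable_fun t -> definable_fun (fun e => f (s e) (t e)).
Proof.
move=> Hf Hs Ht; apply: (definable_app3 (Q := fun a b c => a = f b c)) => //;
  by [exact: definable_fun_var | exact: definable_fun_shift].
Qed.
End Definability.

(* Proof search for definability *)
Create HintDb definable.
#[global] Hint Constants Opaque : definable.
#[global] Hint Resolve definable_and definable_or definable_imp definable_false
  definable_not definable_iff_rel definable_all definable_ex definable_ex1
  definable_fun_var definable_fun_const definable_mem definable_eq : definable.
#[global] Hint Extern 0 (definable _) => assumption : definable.
#[global] Hint Extern 0 (definable_fun _) => assumption : definable.
#[global] Hint Extern 5 (definable _) =>
  progress unfold nonempty, subset, is_upair, is_union, is_inter, is_diff,
    is_succ, inductive_set, is_opair, maps, maps2, is_function, is_injective,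
    is_surjective, is_finite, rle, rlt, covers, is_half_open : definable.

Ltac prove_definable := solve [typeclasses eauto with definable nocore].

Lemma definable_maps (M : set_structure) (f s t : (nat -> M) -> M) :
  definable_fun f -> definable_fun s -> definable_fun t ->
  definable (fun e => maps (f e) (s e) (t e)).
Proof. by apply: definable_app3; prove_definable. Qed.

Lemma definable_maps2 (M : set_structure) (f : M) (r s t : (nat -> M) -> M) :
  definable_fun r -> definable_fun s -> definable_fun t ->
  definable (fun e => maps2 f (r e) (s e) (t e)).
Proof. by apply: definable_app3; prove_definable. Qed.

#[global] Hint Resolve definable_maps definable_maps2 : definable.

(** * Set theory inside a model *)
Section SetTheory.
Context (M : set_structure) (HZF : ZF M) (omega : M) (Homega : is_omega omega).
Implicit Types (A B C F K U f x y z : M).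

Lemma set_ext x y : (forall z, z ∈ x <-> z ∈ y) -> x = y.
Proof. exact: zf_extensionality. Qed.

(* [omega] is a junk value. *)
Definition the (Q : M -> Prop) : M :=
  if pselect (exists! x, Q x) is left H then sval (cid H) else omega.

Lemma the_spec (Q : M -> Prop) : (exists! x, Q x) -> Q (the Q).
Proof. by rewrite /the; case: pselect => // H _; case: cid => x []. Qed.

Lemma the_eq (Q : M -> Prop) x : Q x -> (forall y, Q y -> y = x) -> the Q = x.
Proof.
move=> Qx Ux; apply: (Ux); apply: the_spec; exists x; split=> // y Qy.
by rewrite (Ux _ Qy).
Qed.

(** The junk value is a fixed element, so a description has a definable graph even where unique
    existence fails. Nested terms built from [the] can thus be used in separation and replacement
    without existence proofs. *)
Lemma definable_the (Q : (nat -> M) -> M -> Prop) :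
  definable (fun e => Q (fun n => e n.+1) (e 0)) ->
  definable_fun (fun e => the (Q e)).
Proof.
move=> HQ.
pose D e := (Q (fun n => e n.+1) (e 0) /\ exists! x, Q (fun n => e n.+1) x) \/
  ~ (exists! x, Q (fun n => e n.+1) x) /\ e 0 = omega.
apply: (definable_iff (P := D)) => [e|]; last first.
  have HD : definable (fun e => exists! x, Q (fun n => e n.+1) x).
    apply: definable_ex1.
    by apply: (definable_subst
      (fun n => if n is k.+1 then inl k.+2 else inl 0)) HQ.
  apply: definable_or; apply: definable_and => //; first exact: definable_not.
  prove_definable.
rewrite /D /the; case: pselect => [H|H].
  case: cid => x [Qx Ux] /=; split=> [[[Q0 _]|[]//]|->]; last by left.
  by rewrite (Ux _ Q0).
by split=> [[[]//|[]//]|]; right.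
Qed.

(** The axiom schemas work with one fixed environment, so the constants of [v] become its entries.
    Two indices stay free, for the argument and the value in replacement. *)
Lemma definable_parameters (P : (nat -> M) -> Prop) :
  definable P -> exists p e0, forall a b,
    sat M (scons a (scons b e0)) p <-> P (scons a (scons b (fun=> omega))).
Proof.
move=> [p [v H]].
exists (rename (fun n => match v n with inl 0 => 0 | inl 1 => 1 | _ => n.+2 end) p).
exists (fun n => if v n is inr c then c else omega) => a b.
rewrite sat_rename -H.
set e := (e in sat M e p); set e' := (e in _ <-> sat M e p).
suff -> : e = e' by [].
by apply: funext => n; rewrite /e /e'; case E: (v n) => [[|[|k]]|c] //=; rewrite E.
Qed.

Definition sep A (P : M -> Prop) : M :=
  the (fun y => forall z, z ∈ y <-> z ∈ A /\ P z).

Lemma mem_sep A (P : M -> Prop) : definable (fun e => P (e 0)) ->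
  forall z, z ∈ sep A P <-> z ∈ A /\ P z.
Proof.
move=> /definable_parameters[p [e0 H]].
apply: (the_spec (Q := fun y => forall z, z ∈ y <-> z ∈ A /\ P z)).
(* Separation frees index 0 only; index 1 receives the dummy [omega]. *)
have [y Hy] := zf_separation M HZF p (scons omega e0) A; exists y.
have Hy' z : z ∈ y <-> z ∈ A /\ P z by rewrite Hy H.
by split=> // y' Hy''; apply: set_ext => z; rewrite Hy' Hy''.
Qed.

Definition image (t : M -> M) A : M :=
  the (fun y => forall b, b ∈ y <-> exists a, a ∈ A /\ b = t a).

Lemma mem_image (t : M -> M) A : definable_fun (fun e => t (e 0)) ->
  forall b, b ∈ image t A <-> exists a, a ∈ A /\ b = t a.
Proof.
move=> Ht.
apply: (the_spec (Q := fun y => forall b, b ∈ y <-> exists a, a ∈ A /\ b = t a)).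
have Ht' : definable (fun e => e 1 = t (e 0)).
  exact: definable_eq (@definable_fun_var _ 1) Ht.
have [p [e0 H]] := definable_parameters Ht'.
have [|y Hy] := zf_replacement M HZF p e0 A.
  by move=> a aA; exists (t a); split=> [|b]; rewrite H.
have Hy' b : b ∈ y <-> exists a, a ∈ A /\ b = t a.
  by rewrite Hy; split=> -[a [aA]]; rewrite ?H => Hab; exists a; split; rewrite ?H.
exists y; split=> // y' Hy''; apply: set_ext => z; by rewrite Hy' Hy''.
Qed.

Definition pair x y : M := the (is_upair x y).

Lemma mem_pair x y z : z ∈ pair x y <-> z = x \/ z = y.
Proof.
apply: (the_spec (Q := is_upair x y)) z; have [u Hu] := zf_pairing M HZF x y.
by exists u; split=> // u' Hu'; apply: set_ext => z; rewrite (Hu z) (Hu' z).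
Qed.

Definition union_of C : M := the (is_union C).

Lemma is_union_union_of C : is_union C (union_of C).
Proof.
apply: (the_spec (Q := is_union C)); have [U HU] := zf_union M HZF C.
by exists U; split=> // U' HU'; apply: set_ext => z; rewrite (HU z) (HU' z).
Qed.

Lemma mem_union_of C z : z ∈ union_of C <-> exists A, A ∈ C /\ z ∈ A.
Proof. exact: is_union_union_of. Qed.

Definition adjoin A x : M := union_of (pair A (pair x x)).

Lemma mem_adjoin A x z : z ∈ adjoin A x <-> z ∈ A \/ z = x.
Proof.
rewrite mem_union_of; split=> [[B []]|].
  by rewrite mem_pair => -[->|->]; rewrite ?mem_pair; tauto.
move=> [zA|->]; [exists A | exists (pair x x)]; rewrite !mem_pair; tauto.
Qed.

Definition opair x y : M := pair (pair x x) (pair x y).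

Lemma is_opairE x y p : is_opair x y p <-> p = opair x y.
Proof.
split=> [[s [u [Hs [Hu Hp]]]]|->]; last first.
  by exists (pair x x), (pair x y); split; [|split] => z; rewrite mem_pair.
have Es : s = pair x x by apply: set_ext => z; rewrite (Hs z) mem_pair.
have Eu : u = pair x y by apply: set_ext => z; rewrite (Hu z) mem_pair.
by rewrite /opair -Es -Eu; apply: set_ext => z; rewrite (Hp z) mem_pair.
Qed.

Lemma pair_inj x y y' : pair x y = pair x y' -> y = y'.
Proof.
move=> H.
have : y ∈ pair x y' by rewrite -H mem_pair; right.
have : y' ∈ pair x y by rewrite H mem_pair; right.
by rewrite !mem_pair; intuition congruence.
Qed.

Lemma opair_inj x y x' y' : opair x y = opair x' y' -> x = x' /\ y = y'.
Proof.
move=> H; have E : x = x'.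
  have : pair x x ∈ opair x' y' by rewrite -H mem_pair; left.
  rewrite mem_pair => -[] E; have := mem_pair x x x'; rewrite E mem_pair;
  by intuition congruence.
by split=> //; move: H; rewrite E => /pair_inj /pair_inj.
Qed.

Lemma mapsE f x y : maps f x y <-> opair x y ∈ f.
Proof.
split=> [[p []]|H]; first by rewrite is_opairE => ->.
by exists (opair x y); rewrite is_opairE.
Qed.

Definition app f x : M := the (maps f x).

Definition lam A (t : M -> M) : M := image (fun x => opair x (t x)) A.
End SetTheory.

#[global] Hint Resolve definable_the : definable.
#[global] Hint Extern 5 (definable_fun _) =>
  progress unfold sep, image, adjoin, opair, pair, union_of, lam, app : definable.

(** * Functions, natural numbers and finite sets *)

Section Functions.
Context (M : set_structure) (HZF : ZF M) (omega : M) (Homega : is_omega omega).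
Implicit Types (A B C F K U f x y z : M).
Local Notation sep := (sep omega).
Local Notation opair := (opair omega).
Local Notation adjoin := (adjoin omega).
Local Notation app := (app omega).
Local Notation lam := (lam omega).

Lemma app_eq f A B x y : is_function f A B -> maps f x y -> app f x = y.
Proof.
move=> [fAB fun_f] Hxy; apply: the_eq => // y' Hxy'.
have [p [Hp pf]] := Hxy; have [x' [y0 [x'A [_ Hp']]]] := fAB p pf.
move: Hp'; rewrite (proj1 (is_opairE HZF omega _ _ _) Hp) (is_opairE HZF omega).
move=> /(opair_inj HZF)[E _]; move: x'A; rewrite -E => xA.
by have [z [_ Uz]] := fun_f x xA; rewrite -(Uz y) ?(Uz y').
Qed.

Lemma app_maps f A B x : is_function f A B -> x ∈ A ->
  maps f x (app f x) /\ app f x ∈ B.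
Proof.
move=> fAB xA; have [y [Hy _]] := fAB.2 x xA; rewrite (app_eq fAB Hy); split=> //.
have [p [Hp pf]] := Hy; have [x0 [y0 [_ [y0B Hp']]]] := fAB.1 p pf.
by move: Hp Hp'; rewrite !(is_opairE HZF omega) => -> /(opair_inj HZF)[_ ->].
Qed.

Lemma maps_lam A (t : M -> M) x y : definable_fun (fun e => t (e 0)) ->
  maps (lam A t) x y <-> x ∈ A /\ y = t x.
Proof.
move=> Ht; rewrite (mapsE HZF omega) mem_image //; last first.
  by apply: definable_fun_app2 => //; prove_definable.
by split=> [[a [aA /(opair_inj HZF)[-> ->]]]|[xA ->]]; [|exists x].
Qed.

Lemma lam_function A B (t : M -> M) : definable_fun (fun e => t (e 0)) ->
  (forall x, x ∈ A -> t x ∈ B) -> is_function (lam A t) A B.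
Proof.
move=> Ht HAB; split=> [p|x xA].
  rewrite mem_image //; last first.
    by apply: definable_fun_app2 => //; prove_definable.
  by move=> [x [xA ->]]; exists x, (t x); rewrite (is_opairE HZF omega); auto.
by exists (t x); split=> [|y]; rewrite maps_lam // => -[].
Qed.

Lemma maps_adjoin f x y u v :
  maps (adjoin f (opair x y)) u v <-> maps f u v \/ u = x /\ v = y.
Proof.
rewrite !(mapsE HZF omega) mem_adjoin //.
by split=> -[]; [left|move=> /(opair_inj HZF); right|left|move=> [-> ->]; right].
Qed.

Definition zero : M := sep omega (fun=> False).
Definition succ n : M := adjoin n n.

Lemma zeroP z : ~ z ∈ zero.
Proof. by rewrite mem_sep //; [case | prove_definable]. Qed.

Lemma mem_succ n z : z ∈ succ n <-> z ∈ n \/ z = n.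
Proof. exact: mem_adjoin. Qed.

Lemma zero_omega : zero ∈ omega.
Proof.
have [[[o [Ho oo]] _] _] := Homega; have -> // : zero = o.
by apply: (set_ext HZF) => z; split=> [/zeroP|/Ho].
Qed.

Lemma succ_omega n : n ∈ omega -> succ n ∈ omega.
Proof.
move=> no; have [[_ /(_ n no)[s [Hs so]]] _] := Homega; have -> // : succ n = s.
by apply: (set_ext HZF) => z; rewrite (Hs z) mem_succ.
Qed.

Lemma omega_ind (P : M -> Prop) : definable (fun e => P (e 0)) ->
  P zero -> (forall n, n ∈ omega -> P n -> P (succ n)) ->
  forall n, n ∈ omega -> P n.
Proof.
move=> HP P0 PS n no.
suff /Homega.2/(_ n no) : inductive_set (sep omega P) by rewrite mem_sep // => -[].
split=> [|m]; first exists zero.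
  by split; [exact: zeroP | rewrite mem_sep //; split=> //; exact: zero_omega].
rewrite mem_sep // => -[mo Pm]; exists (succ m); split; first exact: mem_succ.
by rewrite mem_sep //; split; [exact: succ_omega | exact: PS].
Qed.

Lemma omega_trans n : n ∈ omega -> forall m, m ∈ n -> m ⊆ n.
Proof.
apply: (omega_ind (P := fun n => forall m, m ∈ n -> m ⊆ n)); first prove_definable.
  by move=> m /zeroP.
move=> {}n _ IHn m /mem_succ[/IHn H|->] x; rewrite mem_succ; last by left.
by move=> /H; left.
Qed.

Lemma omega_mem n : n ∈ omega -> n ⊆ omega.
Proof.
apply: (omega_ind (P := fun n => n ⊆ omega)); first prove_definable.
  by move=> m /zeroP.
by move=> {}n no IHn m /mem_succ[/IHn|->].
Qed.

Lemma omega_irrefl n : n ∈ omega -> ~ n ∈ n.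
Proof.
apply: (omega_ind (P := fun n => ~ n ∈ n)); first prove_definable.
  exact: zeroP.
move=> {}n no IHn H; apply: IHn; have nS : n ∈ succ n by rewrite mem_succ; right.
by have /mem_succ[/(omega_trans no)/(_ _ nS)|E] := H; last by move: nS; rewrite E.
Qed.

(** Connects inclusion, the order in which convergence is stated, with membership, the order that
    induction follows. *)
Lemma omega_sub n : n ∈ omega -> forall m, m ∈ omega -> m ⊆ n -> m = n \/ m ∈ n.
Proof.
apply: (omega_ind (P := fun n => forall m, m ∈ omega -> m ⊆ n -> m = n \/ m ∈ n)).
- prove_definable.
- by move=> m _ sub_m; left; apply: (set_ext HZF) => z; split=> [/sub_m|/zeroP].
move=> {}n no IHn m mo sub_mn.
have [nm|nm] := pselect (n ∈ m).
  left; apply: (set_ext HZF) => z; split=> [/sub_mn //|].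
  by rewrite mem_succ => -[|-> //]; exact: (omega_trans mo nm).
have /(IHn m mo) : m ⊆ n.
  move=> z zm; have := sub_mn z zm; rewrite mem_succ => -[//|zn].
  by case: nm; rewrite -zn.
by rewrite mem_succ; tauto.
Qed.

Lemma omega_total m n : m ∈ omega -> n ∈ omega -> m ∈ n \/ n ⊆ m.
Proof.
move=> mo; apply: (omega_ind (P := fun n => m ∈ n \/ n ⊆ m)); first prove_definable.
  by right=> z /zeroP.
move=> {}n no [mn|sub_nm]; first by left; rewrite mem_succ; left.
have [<-|nm] := omega_sub mo no sub_nm; first by left; rewrite mem_succ; right.
by right=> z; rewrite mem_succ => -[/sub_nm|->].
Qed.

Lemma succ_inj m n : m ∈ omega -> n ∈ omega -> succ m = succ n -> m = n.
Proof.
move=> mo no E; have : m ∈ succ n by rewrite -E mem_succ; right.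
rewrite mem_succ => -[mn|//].
have : n ∈ succ m by rewrite E mem_succ; right.
rewrite mem_succ => -[nm|->//].
by case: (omega_irrefl mo); apply: omega_trans nm _ mn.
Qed.

Lemma zero_neq_succ n : zero <> succ n.
Proof. by move=> E; case: (@zeroP n); rewrite E mem_succ; right. Qed.

Lemma finite_zero : is_finite omega zero.
Proof.
exists zero, zero; split; first exact: zero_omega.
have nomaps x y : ~ maps zero x y by move=> [p [_ /zeroP]].
split; last split.
- by split=> [p /zeroP|x /zeroP].
- by move=> x x' y /nomaps.
- by move=> y /zeroP.
Qed.

Lemma finite_adjoin F x : is_finite omega F -> is_finite omega (adjoin F x).
Proof.
have [xF|xF] := pselect (x ∈ F).
  have -> // : adjoin F x = F.
  by apply: (set_ext HZF) => z; rewrite mem_adjoin //; split=> [[|->]|]; [| |left].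
move=> [n [f [no [fFn [inj_f surj_f]]]]].
have mapsg := maps_adjoin f x n.
have mapsf y z : maps f y z -> y ∈ F /\ z ∈ n.
  move=> H; have yF : y ∈ F.
    have [p [Hp pf]] := H; have [y' [z' [y'F [_ Hp']]]] := fFn.1 p pf.
    move: Hp Hp'; rewrite !(is_opairE HZF omega) => -> /(opair_inj HZF)[E _].
    by rewrite E.
  by split=> //; rewrite -(app_eq fFn H); have [] := app_maps fFn yF.
exists (succ n), (adjoin f (opair x n)); split; first exact: succ_omega.
split; last split.
- split=> [p|y].
    rewrite mem_adjoin // => -[/fFn.1[y [z [yF [zn Hp]]]]|->].
      by exists y, z; rewrite mem_adjoin // mem_succ; auto.
    by exists x, n; rewrite mem_adjoin // mem_succ (is_opairE HZF omega); auto.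
  rewrite mem_adjoin // => -[yF|->].
    have [z [Hz Uz]] := fFn.2 y yF; exists z; split; first by rewrite mapsg; left.
    by move=> z'; rewrite mapsg => -[/Uz //|[E _]]; case: xF; rewrite -E.
  exists n; split; first by rewrite mapsg; right.
  by move=> z; rewrite mapsg => -[/mapsf[/xF]|[]].
- move=> y y' z; rewrite !mapsg => -[H|[-> ->]] [H'|[-> E]] //.
  + exact: inj_f H H'.
  + by case: (omega_irrefl no); rewrite -{1}E; have [] := mapsf _ _ H.
  + by case: (omega_irrefl no); have [] := mapsf _ _ H'.
- move=> z; rewrite mem_succ => -[/surj_f[y Hy]|->].
    by exists y; rewrite mapsg; left.
  by exists x; rewrite mapsg; right.
Qed.

(* The induction is on the number of elements of [F], inside the model, so
   [Good] and [Phi] have to be definable. *)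
Lemma finite_uniform (Good : M -> Prop) (Phi : M -> M -> Prop) F :
  definable (fun e => Good (e 0)) -> definable (fun e => Phi (e 0) (e 1)) ->
  (exists b, Good b) ->
  (forall b b', Good b -> Good b' -> exists c, Good c /\
     forall U, Phi U b \/ Phi U b' -> Phi U c) ->
  is_finite omega F -> (forall U, U ∈ F -> exists b, Good b /\ Phi U b) ->
  exists b, Good b /\ forall U, U ∈ F -> Phi U b.
Proof.
move=> HGood HPhi Good0 directed [n [f [no [fFn [inj_f _]]]]] HF.
suff : forall m, m ∈ omega ->
    exists b, Good b /\ forall U, U ∈ F -> app f U ∈ m -> Phi U b.
  move=> /(_ n no)[b [Gb Hb]]; exists b; split=> // U UF; apply: Hb => //.
  by have [] := app_maps fFn UF.
apply: omega_ind.
- apply: definable_ex; apply: definable_and.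
    by apply: definable_app1 => //; prove_definable.
  apply: definable_all; apply: definable_imp; first prove_definable.
  apply: definable_imp; first prove_definable.
  by apply: definable_app2 => //; prove_definable.
- by have [b Gb] := Good0; exists b; split=> // U _ /zeroP.
move=> m mo [b [Gb Hb]].
have [[V [VF Vm]]|noV] := pselect (exists V, V ∈ F /\ app f V = m); last first.
  exists b; split=> // U UF; rewrite mem_succ => -[|E]; first exact: Hb.
  by case: noV; exists U.
have [b' [Gb' Hb']] := HF V VF; have [c [Gc Hc]] := directed b b' Gb Gb'.
exists c; split=> // U UF; rewrite mem_succ => -[Um|E]; apply: Hc.
  by left; exact: Hb.
right; suff -> : U = V by [].
apply: (inj_f _ _ m).
  by rewrite -E; have [] := app_maps fFn UF.
by rewrite -Vm; have [] := app_maps fFn VF.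
Qed.
End Functions.

#[global] Hint Extern 5 (definable_fun _) => progress unfold succ : definable.

(** * Binary operations of the model as Rocq functions *)

Section Pairs.
Context (M : set_structure) (HZF : ZF M).
Implicit Types (f A p q x y z : M).

Lemma is_opair_inj x y x' y' p :
  is_opair x y p -> is_opair x' y' p -> x = x' /\ y = y'.
Proof.
by rewrite !(is_opairE HZF p) => E E'; apply: (opair_inj HZF (omega := p)); rewrite -E.
Qed.

Lemma maps2_dom f A x y z : is_binop f A -> maps2 f x y z ->
  x ∈ A /\ y ∈ A /\ z ∈ A.
Proof.
move=> [fA _] [p [Hp [q [Hq qf]]]].
have [x' [y' [z' [p' [x'A [y'A [z'A [Hp' Hq']]]]]]]] := fA q qf.
have [Ep ->] := is_opair_inj Hq Hq'; move: Hp'; rewrite -Ep => Hp'.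
by have [-> ->] := is_opair_inj Hp Hp'.
Qed.

Lemma binop_total f A x y : is_binop f A -> x ∈ A -> y ∈ A ->
  exists z, z ∈ A /\ maps2 f x y z.
Proof.
move=> Hf xA yA; have [z [Hz _]] := Hf.2 x y xA yA; exists z; split=> //.
by have [_ []] := maps2_dom Hf Hz.
Qed.

Definition binop f A (Hf : is_binop f A) (x y : {x | x ∈ A}) : {x | x ∈ A} :=
  let H := cid (binop_total Hf (svalP x) (svalP y)) in exist _ (sval H) (svalP H).1.

Lemma maps2_binop f A (Hf : is_binop f A) (a b : {x | x ∈ A}) z :
  maps2 f (sval a) (sval b) z <-> z = sval (binop Hf a b).
Proof.
rewrite /binop; case: cid => w [wA Hw] /=; split=> [Hz|-> //].
have [v [_ Uv]] := Hf.2 _ _ (svalP a) (svalP b).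
by rewrite -(Uv _ Hz) -(Uv _ Hw).
Qed.
End Pairs.

(** * The real field of a model *)

(* [HZF] is a phantom argument: the instances below depend on it. *)
Definition real (M : set_structure) (HZF : ZF M) (R : real_field M) : Type :=
  {x : M | x ∈ reals R}.

Local Open Scope ring_scope.

Section RealField.
Context (M : set_structure) (HZF : ZF M) (R : real_field M).
Local Notation real := (real HZF R).
Implicit Types x y z : real.

Definition real_add : real -> real -> real := binop HZF (radd_binop M R).
Definition real_mul : real -> real -> real := binop HZF (rmul_binop M R).
Definition real_zero : real := exist _ (rzero R) (rzero_in M R).
Definition real_one : real := exist _ (rone R) (rone_in M R).

Lemma real_valP x : sval x ∈ reals R.
Proof. exact: (proj2_sig x). Qed.

Lemma real_val_inj x y : sval x = sval y -> x = y.
Proof.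
case: x y => [a Ha] [b Hb] /= E; subst b.
by congr exist; apply: Prop_irrelevance.
Qed.

Lemma maps2_add x y z : maps2 (radd R) (sval x) (sval y) (sval z) <-> z = real_add x y.
Proof. by rewrite (maps2_binop HZF); split=> [H|->] //; apply: real_val_inj. Qed.

Lemma maps2_mul x y z : maps2 (rmul R) (sval x) (sval y) (sval z) <-> z = real_mul x y.
Proof. by rewrite (maps2_binop HZF); split=> [H|->] //; apply: real_val_inj. Qed.

Lemma real_addC : commutative real_add.
Proof. by move=> x y; apply/maps2_add/radd_comm/maps2_add. Qed.

Lemma real_addA : associative real_add.
Proof.
move=> x y z; apply/esym/maps2_add.
by apply: (@radd_assoc M R (sval x) (sval y) (sval z)); apply/maps2_add.
Qed.

Lemma real_add0 : left_id real_zero real_add.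
Proof. by move=> x; rewrite real_addC; apply/esym/maps2_add/radd_zero/real_valP. Qed.

Lemma real_opp_ex x : exists y, real_add y x = real_zero.
Proof.
have [y Hy] := radd_opp M R _ (real_valP x).
have [_ [yR _]] := maps2_dom HZF (radd_binop M R) Hy.
by exists (exist _ y yR); rewrite real_addC; apply/esym/maps2_add.
Qed.

Definition real_opp x : real := sval (cid (real_opp_ex x)).

Lemma real_addN : left_inverse real_zero real_opp real_add.
Proof. by move=> x; rewrite /real_opp; case: cid. Qed.

Lemma real_mulC : commutative real_mul.
Proof. by move=> x y; apply/maps2_mul/rmul_comm/maps2_mul. Qed.

Lemma real_mulA : associative real_mul.
Proof.
move=> x y z; apply/esym/maps2_mul.
by apply: (@rmul_assoc M R (sval x) (sval y) (sval z)); apply/maps2_mul.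
Qed.

Lemma real_mul1 : left_id real_one real_mul.
Proof. by move=> x; rewrite real_mulC; apply/esym/maps2_mul/rmul_one/real_valP. Qed.

Lemma real_mulDl : left_distributive real_mul real_add.
Proof.
move=> x y z; rewrite ![real_mul _ z]real_mulC; apply/maps2_add.
by apply: (@rmul_add M R (sval z) (sval x) (sval y));
  [apply/maps2_add | apply/maps2_mul..].
Qed.

Lemma real_one_neq0 : real_one <> real_zero.
Proof. by move=> [/(rone_neq_zero M R)]. Qed.

Lemma real_inv_ex x : x <> real_zero -> exists y, real_mul y x = real_one.
Proof.
move=> x0; have [|y Hy] := rmul_inv M R _ (real_valP x).
  by move=> E; apply/x0/real_val_inj.
have [_ [yR _]] := maps2_dom HZF (rmul_binop M R) Hy.
by exists (exist _ y yR); rewrite real_mulC; apply/esym/maps2_mul.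
Qed.

Definition real_inv x : real :=
  if pselect (x <> real_zero) is left H then sval (cid (real_inv_ex H))
  else real_zero.

Definition real_le x y : bool := `[< rle R (sval x) (sval y) >].

Lemma real_rleP x y : reflect (rle R (sval x) (sval y)) (real_le x y).
Proof. exact: asboolP. Qed.
End RealField.

HB.instance Definition _ M HZF R := gen_eqMixin (@real M HZF R).
(** This choice operator lives in Rocq, where the algebraic hierarchy asks for it. It yields no
    choice function of the model, since that would have to be an element of the model. *)
HB.instance Definition _ M HZF R := gen_choiceMixin (@real M HZF R).
HB.instance Definition _ M HZF R :=
  GRing.isZmodule.Build (@real M HZF R) (@real_addA M HZF R) (@real_addC M HZF R)
    (@real_add0 M HZF R) (@real_addN M HZF R).

Lemma real_oner_neq0 M HZF R : real_one HZF R != 0 :> @real M HZF R.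
Proof. by apply/eqP; apply: real_one_neq0. Qed.

HB.instance Definition _ M HZF R :=
  GRing.Zmodule_isComNzRing.Build (@real M HZF R) (@real_mulA M HZF R)
    (@real_mulC M HZF R) (@real_mul1 M HZF R) (@real_mulDl M HZF R)
    (@real_oner_neq0 M HZF R).

Lemma real_mulVf M HZF R (x : @real M HZF R) : x != 0 -> real_inv x * x = 1.
Proof.
move=> /eqP x0; rewrite /real_inv; case: pselect => // H; by case: cid.
Qed.

Lemma real_inv0 M HZF R : real_inv (0 : @real M HZF R) = 0.
Proof. by rewrite /real_inv; case: pselect => // -[]. Qed.

HB.instance Definition _ M HZF R :=
  GRing.ComNzRing_isField.Build (@real M HZF R) (@real_mulVf M HZF R)
    (@real_inv0 M HZF R).

(** * Order and absolute value on the reals of the model *)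

Section RealOrder.
Context (M : set_structure) (HZF : ZF M) (R : real_field M).
Local Notation real := (real HZF R).
Implicit Types x y z : real.

Definition real_lt x y : bool := (y != x) && real_le x y.
Definition real_norm x : real := if real_le 0 x then x else - x.

Lemma real_le_add x y z : real_le x y -> real_le (x + z) (y + z).
Proof.
move=> /real_rleP xy; apply/real_rleP.
by apply: (rle_add M R _ _ (sval z) _ _ xy); apply/maps2_add.
Qed.

Lemma real_le0_add x y : real_le 0 x -> real_le 0 y -> real_le 0 (x + y).
Proof.
move=> x0 /(real_le_add x); rewrite add0r addrC => /real_rleP yx.
by apply/real_rleP/(rle_trans M R _ _ _ _ yx)/real_rleP.
Qed.

Lemma real_le0_mul x y : real_le 0 x -> real_le 0 y -> real_le 0 (x * y).
Proof.
by move=> /real_rleP x0 /real_rleP y0; apply/real_rleP/(rle_mul M R _ _ _ x0 y0)/maps2_mul.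
Qed.

Lemma real_le0_anti x : real_le 0 x -> real_le x 0 -> x = 0.
Proof.
by move=> /real_rleP x0 /real_rleP x0'; apply/real_val_inj/(rle_antisym M R).
Qed.

Lemma real_sub_ge0 x y : real_le 0 (y - x) = real_le x y.
Proof.
apply/idP/idP => [/(real_le_add x)|/(real_le_add (- x))]; last by rewrite subrr.
by rewrite add0r subrK.
Qed.

Lemma real_le0_total x : real_le 0 x || real_le x 0.
Proof.
by apply/orP; have [H|H] := rle_total M R _ _ (real_valP (0 : real)) (real_valP x);
  [left|right]; apply/real_rleP.
Qed.

Lemma real_normN x : real_norm (- x) = real_norm x.
Proof.
rewrite /real_norm opprK -[X in real_le 0 X]sub0r real_sub_ge0.
have := real_le0_total x; case: ifP => x0; case: ifP => x0' //= _.
by rewrite (real_le0_anti x0' x0) oppr0.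
Qed.

Lemma real_ge0_norm x : real_le 0 x -> real_norm x = x.
Proof. by rewrite /real_norm => ->. Qed.
End RealOrder.

HB.instance Definition _ M HZF R :=
  Num.IntegralDomain_isLeReal.Build (@real M HZF R) (@real_le0_add M HZF R)
    (@real_le0_mul M HZF R) (@real_le0_anti M HZF R) (@real_sub_ge0 M HZF R)
    (@real_le0_total M HZF R) (@real_normN M HZF R) (@real_ge0_norm M HZF R)
    (fun x y => erefl (real_lt x y)).


Section RealTheory.
Context (M : set_structure) (HZF : ZF M) (R : real_field M).
Implicit Types x y : real HZF R.

Lemma rleE x y : rle R (sval x) (sval y) <-> x <= y.
Proof. exact: rwP (real_rleP x y). Qed.

Lemma rltE x y : rlt R (sval x) (sval y) <-> x < y.
Proof.
rewrite lt_neqAle; split=> [[/rleE -> ne]|/andP[/eqP ne /rleE xy]].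
  by rewrite andbT; apply/eqP => E; apply: ne; rewrite E.
by split=> // E; apply/ne/real_val_inj.
Qed.
End RealTheory.

(** * Definability of real arithmetic *)

Section RealDefinability.
Context (M : set_structure) (HZF : ZF M) (R : real_field M).
Local Notation real := (real HZF R).
Implicit Types (e : nat -> M) (x y : (nat -> M) -> real).

Definition to_real (a : M) : real :=
  if pselect (a ∈ reals R) is left H then exist _ a H else 0.

Lemma to_realK (a : M) : a ∈ reals R -> sval (to_real a) = a.
Proof. by rewrite /to_real; case: pselect. Qed.

Lemma sval_to_real (a : real) : to_real (sval a) = a.
Proof. by apply: real_val_inj; rewrite to_realK //; exact: real_valP. Qed.

Lemma definable_to_real (t : (nat -> M) -> M) :
  definable_fun t -> definable_fun (fun e => sval (to_real (t e))).
Proof.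
apply: (definable_fun_app1 (f := fun a => sval (to_real a))).
apply: (definable_iff (P := fun e => e 1%N ∈ reals R /\ e 0%N = e 1%N \/
  ~ e 1%N ∈ reals R /\ e 0%N = rzero R)) => [e|]; last prove_definable.
rewrite /to_real; case: pselect => H /=; last by intuition.
by split=> [[[]|[]]|]; auto.
Qed.

Lemma definable_fun_shift_real x : definable_fun (fun e => sval (x e)) ->
  definable_fun (fun e => sval (x (fun n => e n.+1))).
Proof. exact: (definable_fun_shift S). Qed.

Lemma definable_add x y : definable_fun (fun e => sval (x e)) ->
  definable_fun (fun e => sval (y e)) -> definable_fun (fun e => sval (x e + y e)).
Proof.
move=> /definable_fun_shift_real Hx /definable_fun_shift_real Hy.
apply: (definable_iff (P := fun e =>
  maps2 (radd R) (sval (x (fun n => e n.+1))) (sval (y (fun n => e n.+1))) (e 0%N))).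
  by move=> e; exact: (maps2_binop HZF (radd_binop M R)).
prove_definable.
Qed.

Lemma definable_mul x y : definable_fun (fun e => sval (x e)) ->
  definable_fun (fun e => sval (y e)) -> definable_fun (fun e => sval (x e * y e)).
Proof.
move=> /definable_fun_shift_real Hx /definable_fun_shift_real Hy.
apply: (definable_iff (P := fun e =>
  maps2 (rmul R) (sval (x (fun n => e n.+1))) (sval (y (fun n => e n.+1))) (e 0%N))).
  by move=> e; exact: (maps2_binop HZF (rmul_binop M R)).
prove_definable.
Qed.

Lemma definable_le x y : definable_fun (fun e => sval (x e)) ->
  definable_fun (fun e => sval (y e)) -> definable (fun e => x e <= y e).
Proof.
move=> Hx Hy; apply: (definable_iff (P := fun e => rle R (sval (x e)) (sval (y e)))).
  by move=> e; exact: rleE.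
prove_definable.
Qed.

Lemma definable_lt x y : definable_fun (fun e => sval (x e)) ->
  definable_fun (fun e => sval (y e)) -> definable (fun e => x e < y e).
Proof.
move=> Hx Hy; apply: (definable_iff (P := fun e => rlt R (sval (x e)) (sval (y e)))).
  by move=> e; exact: rltE.
prove_definable.
Qed.

(** [to_real] is total and onto, so a quantifier over reals can be replaced by a quantifier over the
    whole model, with no membership guard in the predicate. *)
Lemma definable_all_real (Q : (nat -> M) -> real -> Prop) :
  definable (fun e => Q (fun n => e n.+1) (to_real (e 0%N))) ->
  definable (fun e => forall a, Q e a).
Proof.
move=> /(definable_all (Q := fun e a => Q e (to_real a))); apply: definable_iff.
by move=> e; split=> H a //; rewrite -(sval_to_real a).
Qed.

Lemma definable_ex_real (Q : (nat -> M) -> real -> Prop) :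
  definable (fun e => Q (fun n => e n.+1) (to_real (e 0%N))) ->
  definable (fun e => exists a, Q e a).
Proof.
move=> /(definable_ex (Q := fun e a => Q e (to_real a))); apply: definable_iff.
move=> e; split=> -[a Ha]; first by exists (to_real a).
by exists (sval a); rewrite sval_to_real.
Qed.
End RealDefinability.

#[global] Hint Resolve definable_to_real definable_all_real definable_ex_real
  : definable.
(* These match only up to unfolding of structure instances, hence the externs. *)
#[global] Hint Extern 4 (definable_fun (fun _ => sval (_ + _))) =>
  refine (definable_add _ _) : definable.
#[global] Hint Extern 4 (definable_fun (fun _ => sval (_ * _))) =>
  refine (definable_mul _ _) : definable.
#[global] Hint Extern 4 (definable (fun _ => is_true (_ <= _))) =>
  refine (definable_le _ _) : definable.
#[global] Hint Extern 4 (definable (fun _ => is_true (_ < _))) =>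
  refine (definable_lt _ _) : definable.

(** * The null sequence 2^-n, suprema and the Archimedean property *)

Section RealAnalysis.
Context (M : set_structure) (HZF : ZF M) (omega : M) (Homega : is_omega omega).
Context (R : real_field M).
Local Notation real := (real HZF R).
Local Notation to_real := (@to_real M HZF R).
Local Notation zero := (zero omega).
Local Notation succ := (succ omega).
Local Notation the := (the omega).
Local Notation sep := (sep omega).
Implicit Types (A B K L : M) (x y z b : real).

(** A set of pairs in which each entry is the initial value 1 at [zero] or half of an entry one step
    earlier. Traces stand in for the recursion theorem: [eps n], the internal 2^-n, is the value at
    [n] shared by all traces that reach [n]. Recursion over [nat] would miss the non-standard
    indices. *)
Definition halving_trace (g : M) : Prop := forall m (y : M), maps g m y ->
  m = zero /\ y = sval (1 : real) \/
  exists k (z : M), k ∈ omega /\ m = succ k /\ maps g k z /\ y = sval (to_real z * 2^-1).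

Definition eps (n : M) : real :=
  to_real (the (fun y : M => exists g, halving_trace g /\ maps g n y)).

Lemma definable_halving_trace g : definable_fun g ->
  definable (fun e => halving_trace (g e)).
Proof.
move=> Hg; apply: (definable_app1 (Q := halving_trace)) => //.
rewrite /halving_trace; prove_definable.
Qed.

#[local] Hint Resolve definable_halving_trace : definable.

Lemma eps_ex n : n ∈ omega ->
  exists! y : M, exists g, halving_trace g /\ maps g n y.
Proof.
apply: (omega_ind HZF Homega
  (P := fun n => exists! y : M, exists g, halving_trace g /\ maps g n y)).
- prove_definable.
- exists (sval (1 : real)); split=> [|y [g [Hg /Hg]]]; last first.
    by case=> [[] //|[k [z [_ [/(zero_neq_succ HZF) []]]]]].
  exists (adjoin omega zero (opair omega zero (sval (1 : real)))).
  split; last by rewrite maps_adjoin //; right.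
  move=> m y; rewrite maps_adjoin // => -[[p [_ /(zeroP HZF)]] //|]; by left.
move=> {}n no [y [[g [Hg Hy]] Uy]].
exists (sval (to_real y * 2^-1)); split=> [|y' [g' [Hg' /Hg'[[]|[k [z]]]]]].
- exists (adjoin omega g (opair omega (succ n) (sval (to_real y * 2^-1)))).
  split; last by rewrite maps_adjoin //; right.
  move=> m z; rewrite maps_adjoin // => -[/Hg[|[k [w [ko [Em [Hw Ez]]]]]]|[-> ->]].
  + by left.
  + by right; exists k, w; rewrite maps_adjoin //; auto.
  + by right; exists n, y; rewrite maps_adjoin //; auto.
- by move=> /esym /(zero_neq_succ HZF).
- move=> [ko [/(succ_inj HZF Homega no ko) En [Hz ->]]].
  by rewrite -(Uy z) //; exists g'; rewrite En.
Qed.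

Lemma eps_zero : eps zero = 1.
Proof.
rewrite /eps; have [g [Hg /Hg]] := the_spec omega (eps_ex (zero_omega HZF Homega)).
case=> [[_ ->]|[k [z [_ [/(zero_neq_succ HZF) []]]]]].
by rewrite sval_to_real.
Qed.

Lemma eps_succ n : n ∈ omega -> eps (succ n) = eps n / 2.
Proof.
move=> no; rewrite {1}/eps.
have [g [Hg /Hg]] := the_spec omega (eps_ex (succ_omega HZF Homega no)).
case=> [[/esym/(zero_neq_succ HZF) []]|[k [z [ko [En [Hz ->]]]]]].
rewrite sval_to_real -(succ_inj HZF Homega no ko En) in Hz *.
rewrite /eps; have [y [_ Uy]] := eps_ex no.
have -> : z = the (fun y : M => exists g, halving_trace g /\ maps g n y).
  rewrite -(Uy z); last by exists g.
  by rewrite -(Uy _ (the_spec omega (eps_ex no))).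
by [].
Qed.

#[local] Hint Extern 5 (definable_fun _) => progress unfold eps : definable.

Lemma eps_gt0 n : n ∈ omega -> 0 < eps n.
Proof.
apply: (omega_ind HZF Homega (P := fun n => 0 < eps n)); first prove_definable.
  by rewrite eps_zero ltr01.
by move=> {}n no IHn; rewrite eps_succ //; lra.
Qed.

Lemma eps_anti m n : m ∈ omega -> n ∈ omega -> m ⊆ n -> eps n <= eps m.
Proof.
move=> mo; apply: (omega_ind HZF Homega (P := fun n => m ⊆ n -> eps n <= eps m)).
- prove_definable.
- move=> sub_m; have -> // : m = zero.
  by apply: (set_ext HZF) => z; split=> [/sub_m //|/(zeroP HZF)].
move=> {}n no IHn sub_m.
have [->//|] := omega_sub HZF Homega (succ_omega HZF Homega no) mo sub_m.
rewrite mem_succ // => -[mn|->]; last by rewrite eps_succ //; have := eps_gt0 no; lra.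
have := IHn (omega_trans HZF Homega no mn); rewrite eps_succ //; have := eps_gt0 no.
lra.
Qed.

Definition sup A : real := to_real (the (fun s =>
  s ∈ reals R /\ (forall x, sval x ∈ A -> x <= to_real s) /\
  (forall b, (forall x, sval x ∈ A -> x <= b) -> to_real s <= b))).

Lemma supP A b0 x0 : A ⊆ reals R -> sval x0 ∈ A -> (forall x, sval x ∈ A -> x <= b0) ->
  (forall x, sval x ∈ A -> x <= sup A) /\
  (forall b, (forall x, sval x ∈ A -> x <= b) -> sup A <= b).
Proof.
move=> AR Ax0 Ab0; rewrite /sup.
suff /(the_spec omega)[_ //] : exists! s, s ∈ reals R /\
    (forall x, sval x ∈ A -> x <= to_real s) /\
    (forall b, (forall x, sval x ∈ A -> x <= b) -> to_real s <= b).
have [||s [sR [ub lub]]] := r_complete M R A AR.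
- by exists (sval x0).
- exists (sval b0); split; first exact: real_valP.
  move=> a aA; rewrite -(to_realK HZF (AR a aA)).
  by apply/rleE/Ab0; rewrite to_realK //; exact: AR.
exists s; split; first split=> //.
  split=> [x xA|b Hb]; apply/rleE; rewrite to_realK //; first exact: ub.
  apply: lub; first exact: real_valP.
  move=> a aA; rewrite -(to_realK HZF (AR a aA)).
  by apply/rleE/Hb; rewrite to_realK //; exact: AR.
move=> s' [s'R [ub' lub']].
suff E : to_real s = to_real s' by rewrite -(to_realK HZF sR) E to_realK.
apply/eqP; rewrite eq_le; apply/andP; split.
  apply/rleE; rewrite to_realK //; apply: lub => [|a aA]; first exact: real_valP.
  rewrite -(to_realK HZF (AR a aA)); apply/rleE/ub'.
  by rewrite to_realK //; exact: AR.
apply: lub' => x xA; apply/rleE; rewrite to_realK //; exact: ub.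
Qed.

(** The Archimedean property, from completeness inside the model. If no [eps n] fell below [d], the
    set of common lower bounds of all [eps n] would contain [d] and have a supremum [s > 0]. From
    [s <= eps (succ n)] follows [2 * s <= eps n] for every [n], so [2 * s] is such a lower bound as
    well and exceeds [s]. *)
Lemma eps_lt d : 0 < d -> exists N, N ∈ omega /\
  forall n, n ∈ omega -> N ⊆ n -> eps n < d.
Proof.
move=> d0; apply: contrapT => noN.
have lbd n : n ∈ omega -> d <= eps n.
  move=> no; rewrite leNgt; apply/negP => lt; apply: noN; exists n; split=> // m mo nm.
  exact: le_lt_trans (eps_anti no mo nm) lt.
pose A := sep (reals R) (fun a => forall n, n ∈ omega -> to_real a <= eps n).
have memA x : sval x ∈ A <-> forall n, n ∈ omega -> x <= eps n.
  rewrite mem_sep ?sval_to_real //; last prove_definable.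
  by split=> [[]//|]; split=> //; exact: real_valP.
have AR : A ⊆ reals R by move=> a; rewrite mem_sep //; [case | prove_definable].
have dA : sval d ∈ A by apply/memA.
have [|ub lub] := @supP A (eps zero) d AR dA.
  by move=> x /memA; apply; exact: zero_omega.
have /ub : sval (2 * sup A) ∈ A.
  apply/memA => n no.
  have : sup A <= eps (succ n) by apply: lub => x /memA; apply; exact: succ_omega.
  by rewrite eps_succ //; lra.
by have := ub d dA; lra.
Qed.

End RealAnalysis.

#[global] Hint Extern 5 (definable_fun _) => progress unfold eps, sup : definable.
#[global] Hint Resolve definable_halving_trace : definable.

(** * The Sorgenfrey line *)
Section Sorgenfrey.
Context (M : set_structure) (HZF : ZF M) (omega : M) (Homega : is_omega omega).
Context (R : real_field M) (tau : M) (Htau : sorgenfrey_topology R tau).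
Local Notation real := (real HZF R).
Local Notation to_real := (@to_real M HZF R).
Local Notation sep := (sep omega).
Local Notation sup := (@sup M HZF omega R).
Local Notation eps := (@eps M HZF omega R).
Implicit Types (A B C F I K L U : M) (x y z b : real).

Lemma mem_sep_real (P : real -> Prop) : definable (fun e => P (to_real (e 0%N))) ->
  forall x, sval x ∈ sep (reals R) (fun a => P (to_real a)) <-> P x.
Proof.
move=> HP x; rewrite mem_sep // sval_to_real; split=> [[]//|]; split=> //.
exact: real_valP.
Qed.

Lemma sep_sub A (P : M -> Prop) : definable (fun e => P (e 0%N)) -> sep A P ⊆ A.
Proof. by move=> HP z; rewrite mem_sep // => -[]. Qed.

Definition inf A : real :=
  sup (sep (reals R) (fun a => forall x, sval x ∈ A -> to_real a <= x)).

Lemma infP A b0 x0 : sval x0 ∈ A -> (forall x, sval x ∈ A -> b0 <= x) ->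
  (forall x, sval x ∈ A -> inf A <= x) /\
  (forall b, (forall x, sval x ∈ A -> b <= x) -> b <= inf A).
Proof.
move=> Ax0 Ab0; rewrite /inf; set L := sep _ _.
have memL b : sval b ∈ L <-> forall x, sval x ∈ A -> b <= x.
  apply: (mem_sep_real (P := fun b => forall x, sval x ∈ A -> b <= x)).
  prove_definable.
have [|||ub lub] := @supP M HZF omega R L x0 b0.
- apply: sep_sub; prove_definable.
- exact/memL.
- by move=> x /memL; apply.
split=> [x xA|b /memL /ub //]; apply: lub => b /memL; exact.
Qed.

Lemma rle_dom (a c : M) : rle R a c -> a ∈ reals R /\ c ∈ reals R.
Proof.
move=> [p [Hp /(rle_rel M R)[a' [c' [a'R [c'R Hp']]]]]].
by have [-> ->] := is_opair_inj HZF Hp Hp'.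
Qed.

(** For the converse, [U] is the union of all basic intervals inside it; taking all of them avoids
    choosing one for each point. *)
Lemma open_iff U : U ∈ tau <-> U ⊆ reals R /\ forall x, sval x ∈ U ->
  exists y, x < y /\ forall z, x <= z -> z < y -> sval z ∈ U.
Proof.
have [[sub_tau [_ [_ [_ union_tau]]]] [B [[Btau base] HB]]] := Htau.
split=> [Utau|[UR HU]].
  split=> [|x xU]; first exact: sub_tau.
  have [C [CB HC]] := base U Utau; have [I [IC xI]] := (HC _).1 xU.
  have [a [c [[ac _] HI]]] := (HB I).1 (CB I IC).
  have [aR cR] := rle_dom ac; have [ax xc] := (HI _).1 xI.
  move: ax xc; rewrite -(to_realK HZF aR) -(to_realK HZF cR) rleE rltE => ax xc.
  exists (to_real c); split=> // z xz zc; apply/HC; exists I; split=> //; apply/HI.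
  rewrite -(to_realK HZF aR) -(to_realK HZF cR) rleE rltE; split=> //.
  exact: le_trans ax xz.
pose C := sep B (fun I => I ⊆ U).
have memC I : I ∈ C <-> I ∈ B /\ I ⊆ U by apply: mem_sep; prove_definable.
apply: (union_tau C); first by move=> I /memC[/Btau].
move=> a; split=> [aU|[I [/memC[_]]]]; last by apply.
have [|y [xy Hy]] := HU (to_real a); first by rewrite to_realK //; exact: UR.
set x := to_real a in xy Hy; have Ea : a = sval x by rewrite /x to_realK //; exact: UR.
pose P z := x <= z /\ z < y.
have HP : definable (fun e => P (to_real (e 0%N))) by rewrite /P; prove_definable.
exists (sep (reals R) (fun a => P (to_real a))).
split; last by rewrite Ea mem_sep_real // /P lexx.
have PR : sep (reals R) (fun a => P (to_real a)) ⊆ reals R.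
  exact: (sep_sub (P := fun a => P (to_real a))).
apply/memC; split.
  apply/HB; exists (sval x), (sval y); rewrite rltE; split=> // c; split.
    move=> cP; have cR := PR c cP; move: cP.
    by rewrite -(to_realK HZF cR) rleE rltE mem_sep_real.
  move=> [xc cy]; have [_ cR] := rle_dom xc; move: xc cy.
  by rewrite -(to_realK HZF cR) rleE rltE mem_sep_real.
move=> c cP; have cR := PR c cP; move: cP.
by rewrite -(to_realK HZF cR) mem_sep_real // => -[]; exact: Hy.
Qed.

Lemma open_sep (P : real -> Prop) : definable (fun e => P (to_real (e 0%N))) ->
  (forall x, P x -> exists y, x < y /\ forall z, x <= z -> z < y -> P z) ->
  sep (reals R) (fun a => P (to_real a)) ∈ tau.
Proof.
move=> HP openP; apply/open_iff; split.
  exact: (sep_sub (P := fun a => P (to_real a))).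
move=> x; rewrite mem_sep_real // => /openP[y [xy Hy]]; exists y; split=> // z xz zy.
by rewrite mem_sep_real //; exact: Hy.
Qed.

(** * Rays, closed sets and compact sets *)

Definition ray_lt x : M := sep (reals R) (fun a => to_real a < x).
Definition ray_ge x : M := sep (reals R) (fun a => x <= to_real a).

Lemma mem_ray_lt x z : sval z ∈ ray_lt x <-> z < x.
Proof. by apply: (mem_sep_real (P := fun z => z < x)); prove_definable. Qed.

Lemma mem_ray_ge x z : sval z ∈ ray_ge x <-> x <= z.
Proof. by apply: (mem_sep_real (P := fun z => x <= z)); prove_definable. Qed.

Lemma open_ray_lt x : ray_lt x ∈ tau.
Proof.
apply: (open_sep (P := fun z => z < x)); first prove_definable.
by move=> z zx; exists x.
Qed.

Lemma open_ray_ge x : ray_ge x ∈ tau.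
Proof.
apply: (open_sep (P := fun z => x <= z)); first prove_definable.
by move=> z xz; exists (z + 1); split=> [|w zw _]; lra.
Qed.

Lemma closed_iff A : is_closed (reals R) tau A <->
  A ⊆ reals R /\ forall x, ~ sval x ∈ A ->
    exists y, x < y /\ forall z, x <= z -> z < y -> ~ sval z ∈ A.
Proof.
split=> [[AR [D [HD /open_iff[_ Dopen]]]]|[AR HA]]; split=> //.
  move=> x xA; have [|y [xy Hy]] := Dopen x.
    by apply/HD; split=> //; exact: real_valP.
  by exists y; split=> // z xz zy; have /HD[] := Hy z xz zy.
exists (sep (reals R) (fun a => ~ a ∈ A)).
have memD a : a ∈ sep (reals R) (fun a => ~ a ∈ A) <-> a ∈ reals R /\ ~ a ∈ A.
  by apply: mem_sep; prove_definable.
split=> //; apply/open_iff; split=> [a /memD[] //|x /memD[_ /HA[y [xy Hy]]]].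
exists y; split=> // z xz zy; apply/memD; split; [exact: real_valP | exact: Hy].
Qed.

(** The open sets that admit some good bound cover [K]. A finite subcover leaves finitely many
    bounds to merge by directedness, and no bound is ever attached to a point, so no choice function
    is involved. In both gap lemmas [Phi U b] says that [U] avoids the interval between [x] and
    [b]. *)
Lemma compact_uniform (Good : real -> Prop) (Phi : M -> real -> Prop) K :
  definable (fun e => Good (to_real (e 0%N))) ->
  definable (fun e => Phi (e 0%N) (to_real (e 1%N))) ->
  is_compact omega (reals R) tau K -> (exists b, Good b) ->
  (forall b b', Good b -> Good b' -> exists c, Good c /\
     forall U, Phi U b \/ Phi U b' -> Phi U c) ->
  (forall z, sval z ∈ K -> exists U b, U ∈ tau /\ sval z ∈ U /\ Good b /\ Phi U b) ->
  exists b, Good b /\ forall z, sval z ∈ K -> exists U, sval z ∈ U /\ Phi U b.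
Proof.
move=> HGood HPhi [KR compactK] [b0 Gb0] directed HK.
pose P U := exists b, Good b /\ Phi U b.
have HP : definable (fun e => P (e 0%N)).
  apply: definable_ex_real; apply: definable_and.
    by apply: (definable_app1 (Q := fun a => Good (to_real a))) => //; prove_definable.
  by apply: (definable_app2 (Q := fun U a => Phi U (to_real a))) => //; prove_definable.
have [||F [FC [finF coverF]]] := compactK (sep tau P).
- exact: sep_sub.
- move=> a aK; have [|U [b [Utau [zU HU]]]] := HK (to_real a).
    by rewrite to_realK //; exact: KR.
  exists U; split; last by rewrite -(to_realK HZF (KR a aK)).
  by rewrite mem_sep //; split=> //; exists b.
have [|||a [Ga Ha]] := @finite_uniform M HZF omega Homega (fun a => Good (to_real a))
  (fun U a => Phi U (to_real a)) F HGood HPhi _ _ finF.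
- by exists (sval b0); rewrite sval_to_real.
- move=> a a' Ga Ga'; have [c [Gc Hc]] := directed _ _ Ga Ga'.
  by exists (sval c); rewrite sval_to_real.
- move=> U /FC; rewrite mem_sep // => -[_ [b [Gb Pb]]].
  by exists (sval b); rewrite sval_to_real.
exists (to_real a); split=> // z /coverF[U [UF zU]]; exists U; split=> //.
exact: Ha.
Qed.

(** Compact sets are closed: [ray_lt x] avoids every [[x, b)], so the bound [x + 1] attached to it
    is arbitrary, and for [z > x] the ray [[z, oo)] avoids [[x, z)]. *)
Lemma compact_right_gap K x : is_compact omega (reals R) tau K -> ~ sval x ∈ K ->
  exists y, x < y /\ forall z, x <= z -> z < y -> ~ sval z ∈ K.
Proof.
move=> compactK xK.
have [|||||y [xy Hy]] := @compact_uniform (fun b => x < b)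
  (fun U b => forall z, sval z ∈ U -> x <= z -> z < b -> False) K _ _ compactK.
- prove_definable.
- prove_definable.
- by exists (x + 1); lra.
- move=> b b' xb xb'; exists (Num.min b b'); split; first by rewrite lt_min xb xb'.
  by move=> U [] HU z zU xz; rewrite lt_min => /andP[zb zb']; exact: HU zU xz _.
- move=> z zK; have [zx|xz|E] := ltgtP z x; last by case: xK; rewrite -E.
    exists (ray_lt x), (x + 1); rewrite mem_ray_lt; split; first exact: open_ray_lt.
    by do 2!split=> //; [lra | move=> w /mem_ray_lt; lra].
  exists (ray_ge z), z; rewrite mem_ray_ge; split; first exact: open_ray_ge.
  by do 2!split=> //; move=> w /mem_ray_ge; lra.
by exists y; split=> // z xz zy /Hy[U [zU HU]]; exact: HU zU xz zy.
Qed.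

(** Points [z < x] are covered by the ray below the midpoint of [z] and [x], all others by
    [[x, oo)], which is open here though not in the usual topology. The largest midpoint in a finite
    subcover bounds the gap. *)
Lemma compact_left_gap K x : is_compact omega (reals R) tau K ->
  exists y, y < x /\ forall z, y < z -> z < x -> ~ sval z ∈ K.
Proof.
move=> compactK.
have [|||||y [xy Hy]] := @compact_uniform (fun b => b < x)
  (fun U b => forall z, sval z ∈ U -> b < z -> z < x -> False) K _ _ compactK.
- prove_definable.
- prove_definable.
- by exists (x - 1); lra.
- move=> b b' xb xb'; exists (Num.max b b'); split; first by rewrite gt_max xb xb'.
  by move=> U [] HU z zU; rewrite gt_max => /andP[zb zb'] xz; exact: HU zU _ xz.
- move=> z zK; have [zx|xz] := ltP z x.
    exists (ray_lt ((z + x) / 2)), ((z + x) / 2); rewrite mem_ray_lt.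
    split; first exact: open_ray_lt.
    by split; [lra | split; [lra | move=> w /mem_ray_lt; lra]].
  exists (ray_ge x), (x - 1); rewrite mem_ray_ge; split; first exact: open_ray_ge.
  by do 2!split=> //; [lra | move=> w /mem_ray_ge; lra].
by exists y; split=> // z yz zx /Hy[U [zU HU]]; exact: HU zU yz zx.
Qed.

(** The gap of [K] to the left of [sup L] is also a gap of [L], so a supremum outside [L] could be
    lowered to [y]. *)
Lemma compact_max K L b0 x0 : is_compact omega (reals R) tau K -> L ⊆ K ->
  sval x0 ∈ L -> (forall x, sval x ∈ L -> x <= b0) -> sval (sup L) ∈ L.
Proof.
move=> compactK LK Lx0 Lb0.
have [ub lub] := supP omega (fun a aL => compactK.1 a (LK a aL)) Lx0 Lb0.
have [y [yL Hy]] := compact_left_gap (sup L) compactK.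
apply: contrapT => supL.
suff : sup L <= y by lra.
apply: lub => x xL; rewrite leNgt; apply/negP => yx; apply: (Hy x yx); last exact: LK.
rewrite lt_neqAle ub // andbT; apply/eqP => E; by rewrite -E in supL.
Qed.

(** * From the k-space property to choice for complete subspaces *)

Lemma is_distE x y (d : M) : is_dist R (sval x) (sval y) d <-> d = sval `|x - y|.
Proof.
split=> [[u [Hu Habs]]|->].
  have [uR _] := maps2_dom HZF (radd_binop M R) Hu.
  move: Hu Habs; rewrite -(to_realK HZF uR); set w := to_real u => Hu.
  have -> : x - y = w by apply/eqP; rewrite subr_eq; apply/eqP/(maps2_add w y x).
  case=> [[/(rleE 0 w) w0 ->]|[/(rleE w 0) w0 Hd]]; first by rewrite ger0_norm.
  have [_ [dR _]] := maps2_dom HZF (radd_binop M R) Hd.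
  move: Hd; rewrite -(to_realK HZF dR) ler0_norm //; set v : real := to_real d.
  move=> /(maps2_add w v 0) E; have {}E : 0 = w + v :> real := E.
  suff -> : v = - w :> real by [].
  by lra.
exists (sval (x - y)); split.
  by apply/maps2_add; rewrite -[real_add _ _]/(x - y + y) subrK.
have [xy|xy] := leP 0 (x - y); [left | right].
  by rewrite (ger0_norm xy); split=> //; exact/(rleE 0 (x - y)).
split; first by apply/(rleE (x - y) 0)/ltW.
rewrite (ltr0_norm xy); apply/(maps2_add (x - y) (- (x - y)) 0)/esym.
exact: subrr.
Qed.

Lemma rlt_zeroE (d : M) : rlt R (rzero R) d -> exists x, 0 < x /\ d = sval x.
Proof.
move=> d0; have [_ dR] := rle_dom d0.1; exists (to_real d); rewrite to_realK //.
by split=> //; apply/(rltE 0 (to_real d)); rewrite to_realK.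
Qed.

Lemma omega_upper m n : m ∈ omega -> n ∈ omega ->
  exists k, k ∈ omega /\ m ⊆ k /\ n ⊆ k.
Proof.
move=> mo no; have [/(omega_trans HZF Homega no) H|H] := omega_total HZF Homega mo no.
  by exists n; split=> //; split.
by exists m; split=> //; split.
Qed.

Lemma complete_closed A : k_space omega (reals R) tau ->
  complete_subspace omega R A -> is_closed (reals R) tau A.
Proof.
move=> [_ [_ kspace]] [AR completeA]; apply/kspace => // K compactK I HI.
apply/closed_iff; split=> [a /HI[/AR] //|x xI].
have [xK|xK] := pselect (sval x ∈ K); last first.
  have [y [xy Hy]] := compact_right_gap compactK xK; exists y; split=> // z xz zy.
  by move=> /HI[_]; exact: Hy.
have xA : ~ sval x ∈ A by move=> xA; apply/xI/HI.
apply: contrapT => nogap; apply: xA.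
pose L n := sep I (fun a => x < to_real a /\ to_real a < x + eps n).
have memL n z : sval z ∈ L n <-> sval z ∈ I /\ x < z /\ z < x + eps n.
  by rewrite mem_sep ?sval_to_real //; prove_definable.
pose t n := sup (L n).
have tL n : n ∈ omega -> sval (t n) ∈ L n.
  move=> no; have [[z zL]|noz] := pselect (exists z, sval z ∈ L n); last first.
    (* If [L n] is empty, then [I] misses all of [[x, x + eps n)], because [x] itself is not in
       [I]. *)
    case: nogap; exists (x + eps n); have := eps_gt0 HZF Homega R no.
    split=> [|z xz zx zI]; first lra.
    apply: noz; exists z; apply/memL; split=> //; split=> //.
    rewrite lt_neqAle xz andbT; apply/eqP => E; by apply: xI; rewrite E.
  apply: (compact_max (b0 := x + eps n) compactK _ zL).
    by move=> a /sep_sub H; have /HI[] : a ∈ I by apply: H; prove_definable.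
  by move=> w /memL[_ [_ /ltW]].
(* Definability of the maxima makes the sequence an element of the model, and completeness speaks of
   such sequences only. *)
have Ht : definable_fun (fun e => sval (t (e 0%N))) by rewrite /t /L; prove_definable.
have tA n : n ∈ omega -> sval (t n) ∈ A by move=> /tL/memL[/HI[]].
have t_near d : 0 < d -> exists N, N ∈ omega /\ forall n, n ∈ omega -> N ⊆ n ->
    x < t n /\ t n < x + d.
  move=> /(eps_lt Homega)[N [No HN]]; exists N; split=> // n no Nn.
  by have /memL[_ [xt tx]] := tL n no; have := HN n no Nn; split=> //; lra.
have [||l [lA Hl]] := completeA (lam omega omega (fun n => sval (t n))).
- exact: lam_function.
- move=> d /rlt_zeroE[d' [/t_near[N [No HN]] ->]]; exists N; split=> // m n.
  move=> a b c mo no Nm Nn; rewrite !maps_lam // => -[_ ->] [_ ->] /is_distE ->.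
  have [? ?] := HN m mo Nm; have [? ?] := HN n no Nn.
  by apply/rltE; rewrite ltr_norml; apply/andP; split; lra.
have El : l = sval (to_real l) by rewrite to_realK //; exact: AR.
suff -> : sval x = l by [].
rewrite El; suff -> : x = to_real l by [].
apply/eqP; rewrite -subr_eq0 -normr_le0 leNgt; apply/negP => d0.
(* Were [x] and the limit distinct, half their distance would serve as tolerance around both, and a
   common late term would violate the triangle inequality. *)
have d2 : 0 < `|x - to_real l| / 2 by lra.
have [N [No HN]] := Hl (sval (`|x - to_real l| / 2)) ((rltE 0 _).2 d2).
have [N' [No' HN']] := t_near _ d2.
have [n [no [Nn Nn']]] := omega_upper No No'.
have [? ?] := HN' n no Nn'.
have : `|t n - to_real l| < `|x - to_real l| / 2.
  apply/rltE; apply: (HN n (sval (t n))) => //; first by rewrite maps_lam.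
  by rewrite {1}El; apply/is_distE.
have := ler_distD (t n) x (to_real l); rewrite [`|x - t n|]ler0_norm; last lra.
lra.
Qed.

(** The case distinction sits inside the description instead of a Rocq conditional, so that the
    element is a definable function of [A] and [lam] can collect the choices into a set. *)
Definition canonical_element A : M := the omega (fun a =>
  (exists x, sval x ∈ A /\ 0 <= x) /\
    a = sval (inf (sep A (fun c => 0 <= to_real c))) \/
  ~ (exists x, sval x ∈ A /\ 0 <= x) /\
    a = sval (inf (sep A (fun c => sup A - 1 <= to_real c)))).

(** If the infimum were outside [A], closedness would leave a gap of [A] to its right, and the end
    of that gap would be a larger lower bound of the section. *)
Lemma closed_inf A b x0 : is_closed (reals R) tau A -> sval x0 ∈ A -> b <= x0 ->
  sval (inf (sep A (fun c => b <= to_real c))) ∈ A.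
Proof.
move=> /closed_iff[_ closedA] Ax0 bx0; set L := sep A _.
have memL x : sval x ∈ L <-> sval x ∈ A /\ b <= x.
  by rewrite mem_sep ?sval_to_real //; prove_definable.
have [||lb glb] := @infP L b x0; [exact/memL | by move=> x /memL[] |].
apply: contrapT => /closedA[y [Ly Hy]].
suff : y <= inf L by lra.
apply: glb => x xL; rewrite leNgt; apply/negP => xy.
by apply: Hy (lb x xL) xy _; have /memL[] := xL.
Qed.

Lemma canonical_element_in A : is_closed (reals R) tau A -> nonempty A ->
  canonical_element A ∈ A.
Proof.
move=> closedA [a aA]; have AR := closedA.1.
have xA : sval (to_real a) ∈ A by rewrite to_realK //; exact: AR.
rewrite /canonical_element.
have [[x [Ax x0]]|neg] := pselect (exists x, sval x ∈ A /\ 0 <= x).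
  rewrite (@the_eq M omega _ (sval (inf (sep A (fun c => 0 <= to_real c))))).
  - exact: closed_inf Ax x0.
  - by left; split=> //; exists x.
  - by move=> y [[]//|[[]]]; exists x.
have [|ub lub] := supP omega (b0 := 0) AR xA.
  by move=> x Ax; rewrite leNgt; apply/negP => /ltW x0; apply: neg; exists x.
rewrite (@the_eq M omega _ (sval (inf (sep A (fun c => sup A - 1 <= to_real c))))).
(* The number [sup A - 1] is below the least upper bound, hence not an upper bound, and the section
   is nonempty. *)
- suff [x [Ax supx]] : exists x, sval x ∈ A /\ sup A - 1 <= x by exact: closed_inf Ax supx.
  apply: contrapT => nox; suff : sup A <= sup A - 1 by lra.
  apply: lub => x Ax; rewrite leNgt; apply/negP => /ltW H; apply: nox; by exists x.
- by right.
- by move=> y [[]//|[]].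
Qed.

Lemma k_space_CC_cR : k_space omega (reals R) tau -> CC_cR omega R.
Proof.
move=> kspace C _ _ HC; exists (lam omega C canonical_element).
have Ht : definable_fun (fun e => canonical_element (e 0%N)).
  by rewrite /canonical_element /inf; prove_definable.
have pickC A : A ∈ C -> canonical_element A ∈ A.
  by move=> /HC[A0 completeA]; apply: canonical_element_in => //; exact: complete_closed.
split=> [|A a]; last by rewrite maps_lam // => -[/pickC ? ->].
exists (union_of omega C); split; first exact: is_union_union_of.
apply: lam_function => // A AC; apply/(mem_union_of HZF); exists A; split=> //.
exact: pickC.
Qed.

(** * From countable choice to the k-space property *)

Lemma omega_least (P : M -> Prop) : definable (fun e => P (e 0%N)) ->
  (exists n, n ∈ omega /\ P n) ->
  exists! n, n ∈ omega /\ P n /\ forall m, m ∈ n -> ~ P m.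
Proof.
move=> HP [k Pk].
have memS n : n ∈ sep omega P <-> n ∈ omega /\ P n by exact: mem_sep.
(* Foundation supplies an element minimal for membership, which is the least one because membership
   orders [omega] linearly. *)
have [|n [/memS[no Pn] minn]] := zf_foundation M HZF (sep omega P).
  by exists k; apply/memS.
have {}minn m : m ∈ n -> ~ P m.
  by move=> mn Pm; apply: (minn m mn); apply/memS; split=> //; exact: omega_mem mn.
exists n; split=> // n' [n'o [Pn' minn']].
have [/minn' //|n'n] := omega_total HZF Homega no n'o.
by have [|/minn] := omega_sub HZF Homega no n'o n'n.
Qed.

Lemma hausdorff_sorgenfrey : is_hausdorff (reals R) tau.
Proof.
have separate x y : x < y -> exists U V, U ∈ tau /\ V ∈ tau /\ sval x ∈ U /\
    sval y ∈ V /\ forall a, ~ (a ∈ U /\ a ∈ V).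
  move=> xy; exists (ray_lt y), (ray_ge y); rewrite mem_ray_lt mem_ray_ge lexx.
  split; first exact: open_ray_lt.
  split; first exact: open_ray_ge.
  do 2!split=> //; move=> a [aU aV].
  have aR : a ∈ reals R by have /open_iff[UR _] := open_ray_lt y; exact: UR.
  move: aU aV; rewrite -(to_realK HZF aR) mem_ray_lt mem_ray_ge; lra.
move=> a b aR bR; rewrite -(to_realK HZF aR) -(to_realK HZF bR) => ab.
have [/separate //|/separate[U [V [UT [VT [bU [aV UV]]]]]]|E] :=
  ltgtP (to_real a) (to_real b); last by case: ab; rewrite E.
by exists V, U; do 4!split=> //; move=> z [zV zU]; case: (UV z).
Qed.

(** One member of the cover contains [x] together with all terms from some [N] on, since the terms
    approach [x] from the right. Only the terms with index in [N] remain. *)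
Lemma compact_convergent (t : M -> M) x : definable_fun (fun e => t (e 0%N)) ->
  (forall n, n ∈ omega -> exists z, t n = sval z /\ x <= z /\ z < x + eps n) ->
  is_compact omega (reals R) tau (adjoin omega (image omega t omega) (sval x)).
Proof.
move=> Ht tx; split=> [a|C Ctau coverC].
  rewrite mem_adjoin // mem_image // => -[[n [/tx[z [-> _]] ->]]|->];
  exact: real_valP.
have [|U [UC xU]] := coverC (sval x); first by rewrite mem_adjoin //; right.
have /open_iff[_ /(_ x xU)[y [xy Hy]]] := Ctau U UC.
have [|N [No HN]] := eps_lt (d := y - x) Homega; first lra.
(* Since [N] may be non-standard, its terms are covered by an induction inside the model. Each stage
   asserts only that a finite subfamily exists, so no member of the cover is chosen for all terms at
   once. *)
have : forall n, n ∈ omega -> exists F, F ⊆ C /\ is_finite omega F /\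
    forall m, m ∈ n -> exists V, V ∈ F /\ t m ∈ V.
  apply: (omega_ind HZF Homega (P := fun n => exists F, F ⊆ C /\
    is_finite omega F /\ forall m, m ∈ n -> exists V, V ∈ F /\ t m ∈ V)).
  - have Happ k : definable_fun (fun e => t (e k)).
      exact: (definable_fun_app1 Ht (definable_fun_var M k)).
    prove_definable.
  - exists (zero omega); split=> [z /(zeroP HZF) //|].
    by split=> [|m /(zeroP HZF) //]; exact: finite_zero.
  move=> n no [F [FC [finF HF]]].
  have [|V [VC nV]] := coverC (t n).
    by rewrite mem_adjoin // mem_image //; left; exists n.
  exists (adjoin omega F V); split=> [W|].
    by rewrite mem_adjoin // => -[/FC|->].
  split=> [|m]; first exact: finite_adjoin.
  rewrite mem_succ // => -[/HF[W [WF mW]]|->].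
    by exists W; rewrite mem_adjoin //; auto.
  by exists V; rewrite mem_adjoin //; auto.
move=> /(_ N No)[F [FC [finF HF]]].
exists (adjoin omega F U); split=> [W|]; first by rewrite mem_adjoin // => -[/FC|->].
split=> [|a]; first exact: finite_adjoin.
rewrite mem_adjoin // mem_image // => -[[n [no ->]]|->]; last first.
  by exists U; rewrite mem_adjoin //; auto.
have [/HF[V [VF nV]]|Nn] := omega_total HZF Homega no No.
  by exists V; rewrite mem_adjoin //; auto.
exists U; rewrite mem_adjoin //; split; first by right.
have [z [-> [xz zx]]] := tx n no; apply: Hy => //; have := HN n no Nn; lra.
Qed.

(** Countable choice applies to the set of values of [L], whose countability needs an injection into
    [omega]. As [L] may repeat values, each value is sent to its first index. *)
Lemma CC_R_sequence (L : M -> M) : CC_R omega R ->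
  definable_fun (fun e => L (e 0%N)) ->
  (forall n, n ∈ omega -> nonempty (L n) /\ L n ⊆ reals R) ->
  exists f, forall n, n ∈ omega -> app omega f (L n) ∈ L n.
Proof.
move=> cc HL HLn; pose C := image omega L omega.
have memC A : A ∈ C <-> exists n, n ∈ omega /\ A = L n by exact: mem_image.
pose first_index A := the omega (fun n => n ∈ omega /\ L n = A /\
  forall m, m ∈ n -> ~ L m = A).
have Happ k : definable_fun (fun e => L (e k)).
  exact: (definable_fun_app1 HL (definable_fun_var M k)).
have Hindex : definable_fun (fun e => first_index (e 0%N)).
  by rewrite /first_index; prove_definable.
have indexP A : A ∈ C -> first_index A ∈ omega /\ L (first_index A) = A.
  move=> /memC[n [no EA]]; have HP : definable (fun e => L (e 0%N) = A) by prove_definable.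
  have least : exists k, k ∈ omega /\ L k = A by exists n.
  by have [? []] := the_spec omega (omega_least (P := fun k => L k = A) HP least).
have [||A /memC[n [no ->]]|f [[U [HU fCU]] Hf]] := cc C.
- by exists (L (zero omega)); apply/memC; exists (zero omega); split=> //; exact: zero_omega.
- exists (lam omega C first_index); split.
    by apply: lam_function => // A /indexP[].
  move=> A A' n; rewrite !maps_lam // => -[/indexP[_ E] ->] [/indexP[_ E'] En].
  by rewrite -E -E' En.
- exact: HLn.
exists f => n no; apply: (Hf (L n)).
by have [] := app_maps HZF omega fCU (proj2 (memC (L n)) (ex_intro _ n (conj no erefl))).
Qed.

Lemma CC_R_k_space : CC_R omega R -> k_space omega (reals R) tau.
Proof.
move=> cc; split; [exact: Htau.1|split; first exact: hausdorff_sorgenfrey].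
move=> A AR; split=> [/closed_iff[_ closedA] K compactK I HI|kA].
  apply/closed_iff; split=> [a /HI[/AR] //|x xI].
  (* A point outside [I] misses [A] or [K], and the gap is taken from the one that it misses. *)
  have [xA|xA] := pselect (sval x ∈ A).
    have [|y [xy Hy]] := compact_right_gap (x := x) compactK.
      by move=> xK; apply/xI/HI.
    by exists y; split=> // z xz zy /HI[_]; exact: Hy.
  have [y [xy Hy]] := closedA x xA.
  by exists y; split=> // z xz zy /HI[+ _]; exact: Hy.
apply/closed_iff; split=> // x xA; apply: contrapT => nogap.
(* The interval may include [x], which is not in [A]. An empty [L n] would be a gap of [A] at
   [x]. *)
pose L n := sep A (fun a => x <= to_real a /\ to_real a < x + eps n).
have memL n z : sval z ∈ L n <-> sval z ∈ A /\ x <= z /\ z < x + eps n.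
  by rewrite mem_sep ?sval_to_real //; prove_definable.
have HL : definable_fun (fun e => L (e 0%N)) by rewrite /L; prove_definable.
have LA n : L n ⊆ A by apply: sep_sub; prove_definable.
have [n no|f Hf] := CC_R_sequence cc HL.
  split; last by move=> a /LA/AR.
  apply: contrapT => L0; apply: nogap; exists (x + eps n).
  have := eps_gt0 HZF Homega R no; split=> [|z xz zx zA]; first lra.
  by apply: L0; exists (sval z); apply/memL.
pose t n := app omega f (L n).
have Ht : definable_fun (fun e => t (e 0%N)) by rewrite /t /L; prove_definable.
have tx n : n ∈ omega -> exists z, t n = sval z /\ x <= z /\ z < x + eps n.
  move=> no; have tR : t n ∈ reals R by apply/AR/LA/Hf.
  exists (to_real (t n)); rewrite to_realK //; split=> //.
  by have /memL[] : sval (to_real (t n)) ∈ L n by rewrite to_realK //; exact: Hf.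
set K := adjoin omega (image omega t omega) (sval x).
have compactK : is_compact omega (reals R) tau K := compact_convergent Ht tx.
pose I := sep A (fun a => a ∈ K).
have memI a : a ∈ I <-> a ∈ A /\ a ∈ K by apply: mem_sep; prove_definable.
have /closed_iff[_ /(_ x)[|y [xy Hy]]] := kA K compactK I memI; first by move=> /memI[].
have [|N [No /(_ N No)HN]] := eps_lt (d := y - x) Homega; first lra.
have [z [Ez [xz zx]]] := tx N No.
(* The term with index [N] lies in [A], in [K] and in [[x, y)], which contradicts the gap of the
   trace at [x]. *)
apply: (Hy z xz); first by have := HN (fun _ => id); lra.
apply/memI; rewrite -Ez; split; first by apply/LA/Hf.
by rewrite mem_adjoin // mem_image //; left; exists N.
Qed.
End Sorgenfrey.

Theorem theorem3p10 (M : set_structure) (HZF : ZF M)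
  (omega : M) (Homega : is_omega omega)
  (R : real_field M)
  (tau : M) (Htau : sorgenfrey_topology R tau) :
  (k_space omega (reals R) tau -> CC_cR omega R) /\
  (CC_R omega R -> k_space omega (reals R) tau).
Proof. by split; [exact: k_space_CC_cR | exact: CC_R_k_space]. Qed.
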